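(* Let $a,b,c\in\mathbb{C}$ with $|a|\le1$, let $\psi=K_c$, i.e. $\psi(z)=e^{\bar c z}$, and $\varphi(z)=az+b$, and suppose that $C_{\psi,\varphi}$ is bounded on $\mathcal{F}^2$. (a) If $|a|<1$, then $\|C_{\psi,\varphi}\|=\left|e^{\frac{\bar c b}{1-a}}\right|\exp\!\left(\frac12\,\frac{\left|\frac{c(1-a)}{\bar a-1}+b\right|^2}{1-|a|^2}\right)$. (b) If $|a|=1$ and $a\neq1$, then $\|C_{\psi,\varphi}\|=\left|e^{\frac{|b|^2}{1-\bar a}}\right|$. (c) If $a=1$, then $\|C_{\psi,\varphi}\|=e^{\frac{|b|^2}{2}}$.
   Context: $\mathcal{F}^2$ is the Fock space: the Hilbert space of entire functions $f$ on $\mathbb{C}$ with $\int_{\mathbb{C}}|f(z)|^2\,d\mu(z)<\infty$, where $d\mu(z)=\pi^{-1}e^{-|z|^2}\,dA(z)$, with inner product $\langle f,g\rangle=\int f\overline{g}\,d\mu$. Its reproducing kernel at $w$ is $K_w(z)=e^{\bar w z}$. The weighted composition operator is $C_{\psi,\varphi}f=\psi\cdot(f\circ\varphi)$. *)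

(* Defs.v *)
From mathcomp Require Import all_boot all_order all_algebra.
From mathcomp Require Import all_classical all_reals all_analysis.
From mathcomp Require Export complex.
Import Order.TTheory GRing.Theory Num.Theory.
Import numFieldNormedType.Exports.

Set Implicit Arguments.
Unset Strict Implicit.
Unset Printing Implicit Defensive.

Local Open Scope classical_set_scope.
Local Open Scope ring_scope.
Local Open Scope complex_scope.

Definition cmod (R : realType) (z : R[i]) : R :=
  Num.sqrt (@complex.Re R z ^+ 2 + @complex.Im R z ^+ 2).

Definition cconj (R : realType) (z : R[i]) : R[i] := @complex.Re R z -i* @complex.Im R z.

Definition cexp (R : realType) (z : R[i]) : R[i] :=
  (expR (@complex.Re R z))%:C * (cos (@complex.Im R z) +i* sin (@complex.Im R z)).

Definition entire (R : realType) (f : R[i] -> R[i]) : Prop :=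
  forall z : R[i], derivable (f : R[i]^o -> R[i]^o) z 1.

Definition fock_weight (R : realType) (p : R * R) : R :=
  expR (- (p.1 ^+ 2 + p.2 ^+ 2)) / pi.

Definition fock_norm2 (R : realType) (f : R[i] -> R[i]) : \bar R :=
  (\int[(@lebesgue_measure R \x @lebesgue_measure R)%E]_p
      ((cmod (f (p.1 +i* p.2))) ^+ 2 * fock_weight p)%:E)%E.

Definition in_fock (R : realType) (f : R[i] -> R[i]) : Prop :=
  entire f /\ (fock_norm2 f < +oo)%E.

(* the Fock space norm ||f|| (meaningful for f in F^2) *)
Definition fock_norm (R : realType) (f : R[i] -> R[i]) : R :=
  Num.sqrt (fine (fock_norm2 f)).

Definition fock_kernel (R : realType) (w : R[i]) : R[i] -> R[i] :=
  fun z => cexp (cconj w * z).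

Definition wcomp (R : realType) (psi phi : R[i] -> R[i]) (f : R[i] -> R[i])
  : R[i] -> R[i] := fun z => psi z * f (phi z).

Definition wcomp_bounded (R : realType) (psi phi : R[i] -> R[i]) : Prop :=
  (forall f, in_fock f -> in_fock (wcomp psi phi f)) /\
  exists M : R, forall f, in_fock f ->
    fock_norm (wcomp psi phi f) <= M * fock_norm f.

Definition wcomp_norm (R : realType) (psi phi : R[i] -> R[i]) : \bar R :=
  ereal_sup [set (fock_norm (wcomp psi phi f))%:E
            | f in [set f | in_fock f /\ fock_norm f <= 1]].

(* Main.v *)
(* If w satisfies b = w - a u with u = c + conj a w, the operator factors as a
   constant times W_u D_a W_{-w}, where the Weyl operators W_u are isometries and
   D_a f = f (a .) is a contraction. The bound |constant| is attained at the
   normalized kernel at w, because C K_w is a multiple of K_u. For |a| < 1 such a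
   w is (b + a c) / (1 - |a|^2); for |a| = 1, boundedness on the kernels forces
   b + a c = 0 and w = 0 works.
   D_a is a contraction because the integral of |f|^2 over the circle of radius
   e^s is midpoint convex in s (a contour shift for f (e^w) conj (f (e^(2s - conj w))),
   by Goursat's bisection argument) and bounded as s tends to -oo, hence
   nondecreasing; Gaussian measure is rotation invariant, so averaging over
   rotations concludes. *)
From HB Require Import structures.
Require Import Defs.
From mathcomp Require Import all_boot all_order all_algebra.
From mathcomp Require Import all_classical all_reals all_analysis.
From mathcomp Require Import complex measurable_realfun ring lra.
Import Order.TTheory GRing.Theory Num.Theory.
Import numFieldNormedType.Exports.
Local Open Scope classical_set_scope.
Local Open Scope ring_scope.
Local Open Scope complex_scope.

(** The condition b = w - a u is stationarity in w of the exponent of ||C K_w|| / ||K_w||, which is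
    |u|^2/2 - |w|^2/2 + Re (conj w b). For |a| < 1 this exponent is strictly concave, so its
    critical point is the only candidate; for |a| = 1 its quadratic terms cancel, leaving |c|^2/2 +
    Re (conj w (b + a c)), which is bounded in w only if b + a c = 0. That D_a is a contraction
    would follow from the orthogonality of the monomials, but [entire] only asserts complex
    differentiability at each point, and power series would have to be derived from it first. The
    convexity argument asks for no more than Cauchy's theorem on rectangles; as the derivative is
    not given to be continuous, that theorem comes from bisection and not from Green's formula.
    Changes of variables in the plane are all reduced, by Tonelli, to translations of the line. *)

(** * Translations, shears and rotations in integrals over the plane *)

Section planar_lebesgue.
Context {R : realType}.
Notation mu := (@lebesgue_measure R).
Local Open Scope ereal_scope.

Lemma lebesgue_measure_translation (k : R) (A : set R) : measurable A ->
  pushforward mu ((fun x => x + k)%R : _ -> measurableTypeR R) A = mu A.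
Proof.
move=> mA; apply/esym/lebesgue_measure_unique => //=.
  exact: measurable_funD.
move=> _ _ [[a b]] _ <-.
rewrite /pushforward/=.
have -> : (fun x : R => (x + k)%R) @^-1` `]a, b]%classic = `](a - k)%R, (b - k)%R]%classic.
  by apply/seteqP; split => x /=; rewrite !in_itv/= ltrBlDr lerBrDr.
by rewrite !lebesgue_measure_itv/= !lte_fin ltrD2r -!EFinB (_ : b - k - (a - k) = b - a)%R//; ring.
Qed.

Lemma ge0_integral_translation (k : R) (f : R -> \bar R) :
  measurable_fun setT f -> (forall x, 0 <= f x) ->
  \int[mu]_x f (x + k)%R = \int[mu]_x f x.
Proof.
move=> mf f0.
have mk : measurable_fun setT ((fun x => x + k)%R : R -> measurableTypeR R).
  exact: measurable_funD.
rewrite -[LHS]/(\int[mu]_(x in ((fun x => x + k)%R : R -> measurableTypeR R) @^-1` setT)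
  (f \o (fun x => x + k)%R) x) -ge0_integral_pushforward//.
by apply: eq_measure_integral => //= A mA _; exact: lebesgue_measure_translation.
Qed.

Notation mu2 := (mu \x mu)%E.

Lemma lebesgue_tonelli1 (F : R * R -> \bar R) :
  measurable_fun setT F -> (forall p, 0 <= F p) ->
  \int[mu2]_p F p = \int[mu]_x \int[mu]_y F (x, y).
Proof.
move=> mF F0.
exact: (@fubini_tonelli1 _ _ (measurableTypeR R) (measurableTypeR R) R mu mu F).
Qed.

Lemma lebesgue_tonelli2 (F : R * R -> \bar R) :
  measurable_fun setT F -> (forall p, 0 <= F p) ->
  \int[mu2]_p F p = \int[mu]_y \int[mu]_x F (x, y).
Proof.
move=> mF F0.
exact: (@fubini_tonelli2 _ _ (measurableTypeR R) (measurableTypeR R) R mu mu F).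
Qed.

Lemma measurable_lebesgue_tonelli3 (F : R * (R * R) -> \bar R) :
  measurable_fun setT F -> (forall q, 0 <= F q) ->
  measurable_fun setT (fun p => \int[mu]_t F (t, p)).
Proof.
move=> mF F0.
exact: (@measurable_fun_fubini_tonelli_G _ _ (measurableTypeR R) _ R mu F mF F0).
Qed.

(* Canonical structure inference does not find mu \x mu to be sigma-finite, so
   only the one-dimensional mu is used as a factor. *)
Lemma lebesgue_tonelli3 (F : R * (R * R) -> \bar R) :
  measurable_fun setT F -> (forall q, 0 <= F q) ->
  \int[mu]_t \int[mu2]_p F (t, p) = \int[mu2]_p \int[mu]_t F (t, p).
Proof.
move=> mF F0.
have mG := measurable_lebesgue_tonelli3 F mF F0.
have mtx : measurable_fun setT (fun q : R * R => \int[mu]_y F (q.1, (q.2, y))).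
  pose F' (q : (R * R) * R) := F (q.1.1, (q.1.2, q.2)).
  have mF' : measurable_fun setT F'.
    apply: (measurableT_comp mF); apply: measurable_fun_pair.
      exact: measurableT_comp.
    by apply: measurable_fun_pair => //; exact: measurableT_comp.
  exact: (@measurable_fun_fubini_tonelli_F _ _ _ (measurableTypeR R) R mu F' mF' (fun q => F0 _)).
have pos q : 0 <= \int[mu]_y F (q.1, (q.2, y)) by exact: integral_ge0.
rewrite (lebesgue_tonelli1 _ mG); last by move=> p; exact: integral_ge0.
transitivity (\int[mu]_t \int[mu]_x \int[mu]_y F (t, (x, y))).
  apply: eq_integral => t _; rewrite (lebesgue_tonelli1 (fun p => F (t, p)))//.
  exact: measurable_fun_pair2.
rewrite -(lebesgue_tonelli1 _ mtx pos) (lebesgue_tonelli2 _ mtx pos).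
apply: eq_integral => x _ /=.
have mx : measurable_fun setT (fun q : R * R => F (q.1, (x, q.2))).
  apply: (measurableT_comp mF); apply: measurable_fun_pair => //.
  exact: measurable_fun_pair.
by rewrite -(lebesgue_tonelli1 _ mx)// (lebesgue_tonelli2 _ mx).
Qed.

(** On each horizontal line the shear is a translation by a constant, so Tonelli reduces it to
    dimension one. *)
Lemma ge0_integral_shear1 (h : R -> R) (F : R * R -> \bar R) :
  measurable_fun setT h -> measurable_fun setT F -> (forall p, 0 <= F p) ->
  \int[mu2]_p F (p.1 + h p.2, p.2)%R = \int[mu2]_p F p.
Proof.
move=> mh mF F0.
have mF' : measurable_fun setT (fun p : R * R => F (p.1 + h p.2, p.2)%R).
  apply: (measurableT_comp mF); apply: measurable_fun_pair => //.
  by apply: measurable_funD => //; exact: measurableT_comp.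
rewrite (lebesgue_tonelli2 _ mF')// (lebesgue_tonelli2 _ mF)//.
apply: eq_integral => y _; rewrite /= (ge0_integral_translation (h y) (fun x => F (x, y)))//.
exact: measurable_fun_pair1.
Qed.

Lemma ge0_integral_shear2 (h : R -> R) (F : R * R -> \bar R) :
  measurable_fun setT h -> measurable_fun setT F -> (forall p, 0 <= F p) ->
  \int[mu2]_p F (p.1, p.2 + h p.1)%R = \int[mu2]_p F p.
Proof.
move=> mh mF F0.
have mF' : measurable_fun setT (fun p : R * R => F (p.1, p.2 + h p.1)%R).
  apply: (measurableT_comp mF); apply: measurable_fun_pair => //.
  by apply: measurable_funD => //; exact: measurableT_comp.
rewrite (lebesgue_tonelli1 _ mF')// (lebesgue_tonelli1 _ mF)//.
apply: eq_integral => x _; rewrite /= (ge0_integral_translation (h x) (fun y => F (x, y)))//.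
exact: measurable_fun_pair2.
Qed.

Lemma ge0_integral_translation2 (u v : R) (F : R * R -> \bar R) :
  measurable_fun setT F -> (forall p, 0 <= F p) ->
  \int[mu2]_p F (p.1 + u, p.2 + v)%R = \int[mu2]_p F p.
Proof.
move=> mF F0; rewrite -(ge0_integral_shear1 (cst u) F)//.
rewrite -(ge0_integral_shear2 (cst v) (fun p => F (p.1 + u, p.2)%R))//=.
by apply: (measurableT_comp mF); apply: measurable_fun_pair => //;
  apply: measurable_funD.
Qed.

(* For c != -1 the rotation is the composite of three shears, with
   k = - tan (theta / 2). *)
Lemma ge0_integral_rotation (c s : R) (F : R * R -> \bar R) :
  (c ^+ 2 + s ^+ 2 = 1)%R ->
  measurable_fun setT F -> (forall p, 0 <= F p) ->
  \int[mu2]_p F (c * p.1 - s * p.2, s * p.1 + c * p.2)%R = \int[mu2]_p F p.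
Proof.
have mlin (k l : R) : measurable_fun setT (fun p : R * R => k * p.1 + l * p.2)%R.
  by apply: measurable_funD; apply: measurable_funM.
have mlinF (k l k' l' : R) (G : R * R -> \bar R) : measurable_fun setT G ->
    measurable_fun setT (fun p : R * R => G (k * p.1 + l * p.2, k' * p.1 + l' * p.2)%R).
  by move=> mG; apply: (measurableT_comp mG); apply: measurable_fun_pair => //; exact: mlin.
have main (c' s' : R) (G : R * R -> \bar R) : (c' ^+ 2 + s' ^+ 2 = 1)%R -> (c' != -1)%R ->
  measurable_fun setT G -> (forall p, 0 <= G p) ->
  \int[mu2]_p G (c' * p.1 - s' * p.2, s' * p.1 + c' * p.2)%R = \int[mu2]_p G p.
  move=> cs cN1 mG G0.
  have c1 : (1 + c' != 0)%R by rewrite addrC -[1%R]opprK subr_eq0.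
  pose k := (- s' / (1 + c'))%R.
  have ks1 : (k + k * c' = - s')%R by rewrite -[X in (X + _)%R]mulr1 -mulrDr mulfVK.
  have ks : (1 + k * s' = c')%R.
    apply: (mulfI c1); transitivity (1 + c' + (k + k * c') * s')%R; first by ring.
    by rewrite ks1 -[X in (X + c' + _)%R]cs; ring.
  have mM (l : R) : measurable_fun setT (fun x : R => l * x)%R by apply: measurable_funM.
  rewrite -(ge0_integral_shear1 _ G (mM k))//.
  pose G1 (p : R * R) := G (p.1 + k * p.2, p.2)%R.
  have mG1 : measurable_fun setT G1.
    rewrite (_ : G1 = fun p : R * R => G (1 * p.1 + k * p.2, 0 * p.1 + 1 * p.2)%R); last first.
      by apply/funext => p; rewrite /G1 !mul1r mul0r add0r.
    exact: mlinF.
  rewrite -(ge0_integral_shear2 _ G1 (mM s'))//; last by move=> p; exact: G0.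
  pose G2 (p : R * R) := G1 (p.1, p.2 + s' * p.1)%R.
  have mG2 : measurable_fun setT G2.
    rewrite (_ : G2 = fun p : R * R => G1 (1 * p.1 + 0 * p.2, s' * p.1 + 1 * p.2)%R).
      exact: mlinF.
    by apply/funext => p; rewrite /G2 !mul1r mul0r addr0 addrC.
  rewrite -(ge0_integral_shear1 _ G2 (mM k))//; last by move=> p; exact: G0.
  apply: eq_integral => p _; rewrite /G2 /G1 /=; congr (G (_, _)).
    transitivity ((1 + k * s') * p.1 + (k + k * (1 + k * s')) * p.2)%R; last by ring.
    by rewrite ks ks1 mulNr.
  transitivity (s' * p.1 + (1 + k * s') * p.2)%R; last by ring.
  by rewrite ks.
move=> cs mF F0; have [cN1|cN1] := eqVneq c (-1)%R; last exact: main.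
have s0 : s = 0%R.
  apply/eqP; rewrite -sqrf_eq0; apply/eqP.
  by move: cs; rewrite cN1 sqrrN expr1n; lra.
have cs' : (0 ^+ 2 + 1 ^+ 2 = 1 :> R)%R by rewrite expr0n expr1n add0r.
have N1 : (0 != -1 :> R)%R by rewrite eq_sym oppr_eq0 oner_eq0.
(* The half turn is the square of the quarter turn, to which [main] applies; hence two successive
   uses. *)
rewrite -[RHS](main 0%R 1%R)//.
pose G (p : R * R) := F (0 * p.1 - 1 * p.2, 1 * p.1 + 0 * p.2)%R.
have mG : measurable_fun setT G.
  rewrite (_ : G = fun p : R * R => F (0 * p.1 + (-1) * p.2, 1 * p.1 + 0 * p.2)%R).
    exact: mlinF.
  by apply/funext => p; rewrite /G mulN1r mul1r.
rewrite -[RHS](main 0%R 1%R G)//; last by move=> p; exact: F0.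
apply: eq_integral => p _; rewrite /G cN1 s0 /=; congr (F (_, _)); ring.
Qed.

(** The plane carries the product sigma-algebra, so an open preimage has to be exhibited as a
    countable union of measurable rectangles: the boxes with rational corners that it contains. *)
Lemma continuous_measurable_fun2 (g : R * R -> R) :
  continuous g -> measurable_fun setT g.
Proof.
move=> cg; apply: (measurability _ (@RGenOpens.measurableE R)).
move=> _ [_ [a [b ->] <-]]; rewrite setTI.
set U := g @^-1` _.
pose box (q : rat * rat * (rat * rat)) : set (R * R) :=
  `]ratr q.1.1, ratr q.1.2[%classic `*` `]ratr q.2.1, ratr q.2.2[%classic.
have UE : U = \bigcup_(q in [set q | box q `<=` U]) box q.
  apply/seteqP; split=> [[x y] Uxy|p [q qU qp]]; last exact: qU.
  have : nbhs (x, y) U.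
    have /cg : nbhs (g (x, y)) `]a, b[%classic by apply: open_nbhs_nbhs; split => //; exact: itv_open.
    exact.
  case=> -[A B] /= [] /nbhs_ballP[e /= e0 eA] /nbhs_ballP[d /= d0 dB] AB.
  have /rat_in_itvoo[q1] : (x - e < x)%R by rewrite ltrBlDr ltrDl.
  have /rat_in_itvoo[q2] : (x < x + e)%R by rewrite ltrDl.
  have /rat_in_itvoo[q3] : (y - d < y)%R by rewrite ltrBlDr ltrDl.
  have /rat_in_itvoo[q4] : (y < y + d)%R by rewrite ltrDl.
  rewrite !in_itv/= => /andP[h1 h2] /andP[h3 h4] /andP[h5 h6] /andP[h7 h8].
  exists ((q1, q2), (q3, q4)); last by split => /=; rewrite in_itv/= ?h7 ?h8 ?h1 ?h2 ?h3 ?h4 ?h5 ?h6.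
  move=> [x' y'] [] /=; rewrite !in_itv/= => /andP[k1 k2] /andP[k3 k4].
  apply: AB; split; [apply: eA|apply: dB]; rewrite /ball/= ltr_norml; apply/andP; split; lra.
rewrite UE bigcup_mkcond; apply: countable_bigcupT_measurable => [|q]; first exact: countableP.
by case: ifPn => // _; exact: measurableX.
Qed.

End planar_lebesgue.

(** * Integrals of continuous functions over segments *)

Section segment_integral.
Context {R : realType}.
Notation mu := (@lebesgue_measure R).
Implicit Types (g : R -> R) (a b c x : R).

(** Unoriented: for b < a the domain is empty and the value is 0, so additivity needs the endpoints
    in order. *)
Definition segint (g : R -> R) (a b : R) : R := \int[mu]_(x in `[a, b]) g x.

Lemma integrable_segment g a b : continuous g ->
  mu.-integrable `[a, b] (EFin \o g).
Proof.
move=> cg; apply: continuous_compact_integrable; first exact: segment_compact.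
exact: continuous_subspaceT.
Qed.

Lemma segint_cat g a b c : continuous g -> a <= b -> b <= c ->
  segint g a c = segint g a b + segint g b c.
Proof.
move=> cg ab bc; apply/eqP; rewrite addrC -subr_eq /segint.
rewrite Rintegral_itvB ?bnd_simp//; last exact: integrable_segment.
rewrite Rintegral_itv_obnd_cbnd//.
apply: (@integrableS _ _ _ mu `[b, c]) => //; last exact: integrable_segment.
by apply: subset_itvr; rewrite bnd_simp.
Qed.

Lemma le_segint g h a b : continuous g -> continuous h ->
  (forall x, a <= x <= b -> g x <= h x) -> segint g a b <= segint h a b.
Proof.
move=> cg ch gh; apply: le_Rintegral => //; try exact: integrable_segment.
Qed.

Lemma segint_affine (al be : R) a b : a <= b ->
  segint (fun x => al + be * x) a b = al * (b - a) + be * (b ^+ 2 - a ^+ 2) / 2.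
Proof.
rewrite le_eqVlt => /predU1P[->|ab].
  by rewrite /segint set_itv1 Rintegral_set1 !subrr !mulr0 mul0r addr0.
pose F x := al * x + be / 2 * x ^+ 2.
have dF x : is_derive x 1 F (al + be * x).
  rewrite /F; apply: is_derive_eq.
  by rewrite /GRing.scale /=; field.
rewrite /segint /Rintegral (@continuous_FTC2 R _ F)//.
- by rewrite -EFinB /= /F; field.
- apply: continuous_subspaceT => x; apply: cvgD; first exact: cvg_cst.
  by apply: cvgM; [exact: cvg_cst|exact: cvg_id].
- have cF x : {for x, continuous F} by apply/differentiable_continuous/derivable1_diffP; case: (dF x).
  split; first by move=> x _; case: (dF x).
  + by apply: cvg_at_right_filter; exact: cF.
  + by apply: cvg_at_left_filter; exact: cF.
- by move=> x _; rewrite derive1E; exact: derive_val.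
Qed.

Lemma segint_affine_approx g (al be e : R) a b : continuous g -> a <= b ->
  (forall x, a <= x <= b -> `|g x - (al + be * x)| <= e) ->
  `|segint g a b - (al * (b - a) + be * (b ^+ 2 - a ^+ 2) / 2)| <= e * (b - a).
Proof.
move=> cg ab ge.
have caff k : continuous (fun x : R => k + be * x).
  move=> x; apply: cvgD; first exact: cvg_cst.
  by apply: cvgM; [exact: cvg_cst|exact: cvg_id].
have : segint g a b <= segint (fun x => (al + e) + be * x) a b.
  by apply: le_segint => // x /ge; rewrite ler_norml => /andP[_]; lra.
have : segint (fun x => (al - e) + be * x) a b <= segint g a b.
  by apply: le_segint => // x /ge; rewrite ler_norml => /andP[+ _]; lra.
rewrite !segint_affine// => h1 h2; rewrite ler_norml; apply/andP; split; lra.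
Qed.

End segment_integral.

(** * Goursat's theorem on rectangles, for real 1-forms *)

Section goursat.
Context {R : realType}.
Variables P Q : R -> R -> R.

(* The 1-form P ds + Q dt is totally differentiable and closed at (s0, t0). *)
Definition closed_form_at (s0 t0 : R) := exists p1 p2 q2 : R,
  forall e, 0 < e -> exists2 d, 0 < d & forall s t, `|s - s0| < d -> `|t - t0| < d ->
    `|P s t - (P s0 t0 + p1 * (s - s0) + p2 * (t - t0))| <= e * (`|s - s0| + `|t - t0|) /\
    `|Q s t - (Q s0 t0 + p2 * (s - s0) + q2 * (t - t0))| <= e * (`|s - s0| + `|t - t0|).

Hypothesis PQ : forall s t, closed_form_at s t.

Lemma lipschitz_at_continuous (g : R -> R) (x0 : R) :
  (exists k, exists2 d, 0 < d & forall x, `|x - x0| < d -> `|g x - g x0| <= k * `|x - x0|) ->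
  {for x0, continuous g}.
Proof.
move=> [k [d d0 H]]; apply/cvgrPdist_lt => e e0.
have k1 : 0 < `|k| + 1 by rewrite ltr_wpDl.
near=> x.
have xd : `|x - x0| < d by rewrite distrC; near: x; exact: cvgr_dist_lt.
rewrite distrC (le_lt_trans (H _ xd))//.
rewrite (@le_lt_trans _ _ ((`|k| + 1) * `|x - x0|))//.
  by rewrite ler_wpM2r// (le_trans (ler_norm _))// lerDl.
rewrite -ltr_pdivlMl// distrC; near: x; apply: cvgr_dist_lt => //.
by rewrite mulr_gt0// invr_gt0.
Unshelve. all: by end_near. Qed.

Lemma closed_form_continuous1 t : continuous (P ^~ t).
Proof.
move=> s; apply: lipschitz_at_continuous.
have [p1 [p2 [q2 /(_ 1 ltr01)[d d0 H]]]] := PQ s t.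
exists (`|p1| + 1), d => // x xd.
have := (H x t xd); rewrite subrr normr0 => /(_ d0)[+ _].
rewrite mulr0 !addr0 mul1r => h.
rewrite (_ : P x t - P s t = (P x t - (P s t + p1 * (x - s))) + p1 * (x - s)); last ring.
by rewrite (le_trans (ler_normD _ _))// normrM; lra.
Qed.

Lemma closed_form_continuous2 s : continuous (Q s).
Proof.
move=> t; apply: lipschitz_at_continuous.
have [p1 [p2 [q2 /(_ 1 ltr01)[d d0 H]]]] := PQ s t.
exists (`|q2| + 1), d => // x xd.
have := (H s x); rewrite subrr normr0 => /(_ d0 xd)[_ +].
rewrite mulr0 !addr0 mul1r add0r => h.
rewrite (_ : Q s x - Q s t = (Q s x - (Q s t + q2 * (x - t))) + q2 * (x - t)); last ring.
by rewrite (le_trans (ler_normD _ _))// normrM; lra.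
Qed.

Let cP := closed_form_continuous1.
Let cQ := closed_form_continuous2.

(** Counterclockwise circulation around the rectangle with lower left corner c and sides l, m. The
    top and left sides carry a minus sign because [segint] is unoriented. *)
Let circ (c : R * R) (l m : R) :=
  segint (P ^~ c.2) c.1 (c.1 + l) + segint (Q (c.1 + l)) c.2 (c.2 + m)
  - segint (P ^~ (c.2 + m)) c.1 (c.1 + l) - segint (Q c.1) c.2 (c.2 + m).

(** Each inner edge is shared by two of the four quarters, which traverse it in opposite
    directions. *)
Let circ_split (s t l m : R) : 0 <= l -> 0 <= m ->
  circ (s, t) (l + l) (m + m) =
  circ (s, t) l m + circ (s + l, t) l m + circ (s, t + m) l m + circ (s + l, t + m) l m.
Proof.
move=> l0 m0; rewrite /circ /= !addrA.
have E1 x : segint (P ^~ x) s (s + l + l) = segint (P ^~ x) s (s + l) + segint (P ^~ x) (s + l) (s + l + l).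
  by apply: segint_cat => //; rewrite lerDl.
have E2 x : segint (Q x) t (t + m + m) = segint (Q x) t (t + m) + segint (Q x) (t + m) (t + m + m).
  by apply: segint_cat => //; rewrite lerDl.
rewrite !E1 !E2; ring.
Qed.

(** The affine part of the form has zero circulation, because its two cross coefficients are the
    same [p2]. The remainder is at most e (l + m) along a boundary of length 2 (l + m). *)
Let circ_small (s0 t0 e : R) : 0 < e -> exists2 d, 0 < d & forall (c : R * R) l m,
  l < d -> m < d -> c.1 <= s0 <= c.1 + l -> c.2 <= t0 <= c.2 + m ->
  `|circ c l m| <= 2 * e * (l + m) ^+ 2.
Proof.
move=> e0; have [p1 [p2 [q2 /(_ e e0)[d d0 H]]]] := PQ s0 t0.
exists d => // -[s t] l m /= ld md /andP[s1 s2] /andP[t1 t2].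
have l0 : 0 <= l by lra.
have m0 : 0 <= m by lra.
have sl : s <= s + l by lra.
have tm : t <= t + m by lra.
have near_ x y : s <= x <= s + l -> t <= y <= t + m ->
    [/\ `|x - s0| < d, `|y - t0| < d & `|x - s0| + `|y - t0| <= l + m].
  move=> /andP[? ?] /andP[? ?].
  have h1 : `|x - s0| <= l by rewrite ler_norml; apply/andP; split; lra.
  have h2 : `|y - t0| <= m by rewrite ler_norml; apply/andP; split; lra.
  by split; lra.
have HP y : t <= y <= t + m ->
  `|segint (P ^~ y) s (s + l) - ((P s0 t0 - p1 * s0 + p2 * (y - t0)) * (s + l - s) +
      p1 * ((s + l) ^+ 2 - s ^+ 2) / 2)| <= e * (l + m) * (s + l - s).
  move=> yt; apply: segint_affine_approx => // x xs.
  have [h1 h2 h3] := near_ _ _ xs yt; have [+ _] := H _ _ h1 h2.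
  rewrite (_ : P s0 t0 + p1 * (x - s0) + p2 * (y - t0) =
    P s0 t0 - p1 * s0 + p2 * (y - t0) + p1 * x); last ring.
  by move=> h; apply: (le_trans h); rewrite ler_wpM2l// ltW.
have HQ x : s <= x <= s + l ->
  `|segint (Q x) t (t + m) - ((Q s0 t0 - q2 * t0 + p2 * (x - s0)) * (t + m - t) +
      q2 * ((t + m) ^+ 2 - t ^+ 2) / 2)| <= e * (l + m) * (t + m - t).
  move=> xs; apply: segint_affine_approx => // y yt.
  have [h1 h2 h3] := near_ _ _ xs yt; have [_ +] := H _ _ h1 h2.
  rewrite (_ : Q s0 t0 + p2 * (x - s0) + q2 * (y - t0) =
    Q s0 t0 - q2 * t0 + p2 * (x - s0) + q2 * y); last ring.
  by move=> h; apply: (le_trans h); rewrite ler_wpM2l// ltW.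
have /HP : t <= t <= t + m by rewrite lexx.
have /HP : t <= t + m <= t + m by rewrite lexx andbT.
have /HQ : s <= s <= s + l by rewrite lexx.
have /HQ : s <= s + l <= s + l by rewrite lexx andbT.
rewrite /circ/= !ler_norml => /andP[a1 a2] /andP[b1 b2] /andP[c1 c2] /andP[d1 d2].
apply/andP; split; nra.
Qed.

(** The hypothesis makes the intervals with left end [u n] and length [l / 2 ^+ n] nested; the
    supremum of the left ends lies in all of them. *)
Lemma nested_dyadic (u : nat -> R) (l : R) :
  (forall n, u n <= u n.+1 <= u n + l / 2 ^+ n.+1) ->
  exists x, forall n, u n <= x <= u n + l / 2 ^+ n.
Proof.
move=> ul.
have half n : l / 2 ^+ n = l / 2 ^+ n.+1 + l / 2 ^+ n.+1.
  by rewrite exprS; field; rewrite expf_neq0.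
have un : nondecreasing_seq u by apply/nondecreasing_seqP => n; have /andP[] := ul n.
have vn : nonincreasing_seq (fun n => u n + l / 2 ^+ n).
  by apply/nonincreasing_seqP => n; have /andP[] := ul n; rewrite (half n); lra.
have l0 n : 0 <= l / 2 ^+ n by rewrite half; have /andP[] := ul n; lra.
have uv m n : u m <= u n + l / 2 ^+ n.
  have h1 := un _ _ (leq_maxl m n); have h2 := vn _ _ (leq_maxr m n).
  by have := l0 (maxn m n); move: h1 h2 => /=; lra.
exists (sup (range u)) => n; apply/andP; split.
  apply: sup_upper_bound; last by exists n.
  by split; [exists (u 0%N), 0%N|exists (u 0%N + l / 2 ^+ 0) => _ [m _ <-]; exact: uv].
apply: ge_sup; first by exists (u 0%N), 0%N.
by move=> _ [m _ <-]; exact: uv.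
Qed.

(** If all four quarters failed the bound, their sum would be smaller in modulus than the whole
    circulation. Of the location of c' only the bounds used by [nested_dyadic] are kept. *)
Let circ_quarter (c : R * R) (l m : R) : 0 <= l -> 0 <= m -> exists c' : R * R,
  [/\ c.1 <= c'.1 <= c.1 + l, c.2 <= c'.2 <= c.2 + m &
  `|circ c (l + l) (m + m)| <= 4 * `|circ c' l m|].
Proof.
case: c => s t l0 m0 /=; rewrite circ_split//.
set a1 := circ (s, t) l m; set a2 := circ (s + l, t) l m.
set a3 := circ (s, t + m) l m; set a4 := circ (s + l, t + m) l m.
have tri : `|a1 + a2 + a3 + a4| <= `|a1| + `|a2| + `|a3| + `|a4|.
  by rewrite !(le_trans (ler_normD _ _))// lerD2r// (le_trans (ler_normD _ _))// lerD2r// ler_normD.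
apply: contrapT => /forallNP H.
have F c' : c'.1 = s \/ c'.1 = s + l -> c'.2 = t \/ c'.2 = t + m ->
    4 * `|circ c' l m| < `|a1 + a2 + a3 + a4|.
  move=> h1 h2; rewrite ltNge; apply/negP => h; apply: (H c'); split => //.
    by case: h1 => ->; apply/andP; split; lra.
  by case: h2 => ->; apply/andP; split; lra.
have := F (s, t) (or_introl erefl) (or_introl erefl).
have := F (s + l, t) (or_intror erefl) (or_introl erefl).
have := F (s, t + m) (or_introl erefl) (or_intror erefl).
have := F (s + l, t + m) (or_intror erefl) (or_intror erefl).
rewrite -/a1 -/a2 -/a3 -/a4; lra.
Qed.

Lemma goursat_rectangle (s t l m : R) : 0 <= l -> 0 <= m ->
  segint (P ^~ t) s (s + l) + segint (Q (s + l)) t (t + m)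
  - segint (P ^~ (t + m)) s (s + l) - segint (Q s) t (t + m) = 0.
Proof.
move=> l0 m0; rewrite -[LHS]/(circ (s, t) l m).
have p2 n : (2 ^+ n != 0 :> R) by rewrite expf_neq0.
have hl n : 0 <= l / 2 ^+ n by rewrite divr_ge0// exprn_ge0.
have hm n : 0 <= m / 2 ^+ n by rewrite divr_ge0// exprn_ge0.
pose next n c := sval (cid (circ_quarter c _ _ (hl n.+1) (hm n.+1))).
pose c := fix c n := if n is k.+1 then next k (c k) else (s, t).
have cS n : [/\ (c n).1 <= (c n.+1).1 <= (c n).1 + l / 2 ^+ n.+1,
    (c n).2 <= (c n.+1).2 <= (c n).2 + m / 2 ^+ n.+1 &
    `|circ (c n) (l / 2 ^+ n) (m / 2 ^+ n)| <=
     4 * `|circ (c n.+1) (l / 2 ^+ n.+1) (m / 2 ^+ n.+1)|].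
  have half x : x / 2 ^+ n = x / 2 ^+ n.+1 + x / 2 ^+ n.+1 :> R.
    by rewrite exprS; field.
  rewrite (half l) (half m) /=.
  exact: (svalP (cid (circ_quarter (c n) _ _ (hl n.+1) (hm n.+1)))).
have [s0 Hs] : exists x, forall n, (c n).1 <= x <= (c n).1 + l / 2 ^+ n.
  by apply: nested_dyadic => n; case: (cS n).
have [t0 Ht] : exists x, forall n, (c n).2 <= x <= (c n).2 + m / 2 ^+ n.
  by apply: nested_dyadic => n; case: (cS n).
have big n : `|circ (s, t) l m| <= 4 ^+ n * `|circ (c n) (l / 2 ^+ n) (m / 2 ^+ n)|.
  elim: n => [|n IH]; first by rewrite !expr0 !divr1 mul1r.
  apply: (le_trans IH); rewrite exprSr -mulrA ler_wpM2l ?exprn_ge0//.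
  by have [] := cS n.
apply/eqP; rewrite -normr_eq0 eq_le normr_ge0 andbT.
apply/ler_addgt0Pr => e e0; rewrite add0r.
(* After n bisections the bound of [circ_small] carries a factor 4^-n, which cancels the 4^n of
   [big]; what remains is 2 (l + m)^2 times the tolerance. The added 1 keeps the divisor positive
   when l = m = 0. *)
have L0 : 0 < 2 * (l + m) ^+ 2 + 1 by rewrite ltr_wpDl// mulr_ge0// sqr_ge0.
have [d d0 small] := circ_small s0 t0 _ (divr_gt0 e0 L0).
have [n [ln mn]] : exists n, l / 2 ^+ n < d /\ m / 2 ^+ n < d.
  have lm0 : 0 <= (l + m) / d by rewrite divr_ge0 ?addr_ge0// ltW.
  have [n Hn] : exists n, (l + m) / d < 2 ^+ n.
    exists (Num.trunc ((l + m) / d)).+1.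
    apply: (lt_trans (truncnS_gt _)).
    by rewrite -natrX ltr_nat ltn_expl.
  have Hn' : l + m < 2 ^+ n * d by rewrite -ltr_pdivrMr.
  by exists n; split; rewrite ltr_pdivrMr ?exprn_gt0// mulrC; lra.
apply: (le_trans (big n)).
have := small (c n) _ _ ln mn (Hs n) (Ht n).
rewrite -mulrDl exprMn exprVn -exprM mulnC exprM (_ : 2 ^+ 2 = 4 :> R); last by ring.
move=> h; apply: (@le_trans _ _ (4 ^+ n * (2 * (e / (2 * (l + m) ^+ 2 + 1)) * ((l + m) ^+ 2 / 4 ^+ n)))).
  by rewrite ler_wpM2l// exprn_ge0.
rewrite (_ : 4 ^+ n * _ = e * (2 * (l + m) ^+ 2) / (2 * (l + m) ^+ 2 + 1)); last first.
  by field; rewrite gt_eqF//= expf_neq0.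
by rewrite ler_pdivrMr// ler_wpM2l ?lerDl// ltW.
Qed.

End goursat.

(** * The modulus as a real number *)

Section cmod_theory.
Context {R : realType}.
Implicit Types z w : R[i].
Local Notation Re := (@complex.Re R).
Local Notation Im := (@complex.Im R).

(** The norm on [R[i]] takes its values in [R[i]]; this identity, with injectivity of the embedding
    of the reals, transfers its laws to [cmod]. *)
Lemma normr_cmod z : `|z| = (cmod z)%:C. Proof. exact: normc_def. Qed.

Lemma cconjE z : cconj z = z^*%C. Proof. by case: z. Qed.

Lemma cmod_ge0 z : 0 <= cmod z. Proof. exact: sqrtr_ge0. Qed.

Lemma cmodM z w : cmod (z * w) = cmod z * cmod w.
Proof. by apply: complexI; rewrite rmorphM/= -!normr_cmod normrM. Qed.

Lemma cmodD z w : cmod (z + w) <= cmod z + cmod w.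
Proof. by rewrite -lecR rmorphD/= -!normr_cmod ler_normD. Qed.

Lemma cmodN z : cmod (- z) = cmod z.
Proof. by apply: complexI; rewrite -!normr_cmod normrN. Qed.

Lemma cmodV z : cmod z^-1 = (cmod z)^-1.
Proof. by apply: complexI; rewrite fmorphV/= -!normr_cmod normfV. Qed.

Lemma cmodJ z : cmod (cconj z) = cmod z.
Proof. by rewrite /cmod /= sqrrN. Qed.

Lemma cmod_sqr z : cmod z ^+ 2 = Re z ^+ 2 + Im z ^+ 2.
Proof. by rewrite sqr_sqrtr// addr_ge0// sqr_ge0. Qed.

Lemma cmod_sqrC z : (cmod z ^+ 2)%:C = z * cconj z.
Proof. by rewrite cconjE -sqr_normc normr_cmod rmorphXn. Qed.

Lemma cmod_real (x : R) : cmod x%:C = `|x|.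
Proof. by rewrite /cmod /= expr0n addr0 sqrtr_sqr. Qed.

Lemma cmod0 : cmod (0 : R[i]) = 0. Proof. by rewrite -[0]/(0%:C) cmod_real normr0. Qed.

Lemma cmod1 : cmod (1 : R[i]) = 1. Proof. by rewrite -[1]/(1%:C) cmod_real normr1. Qed.

Lemma cmod_eq0 z : (cmod z == 0) = (z == 0).
Proof. by rewrite -[RHS]normr_eq0 normr_cmod -(inj_eq (@complexI R)). Qed.

Lemma cReD z w : Re (z + w) = Re z + Re w. Proof. by case: z w => ? ? []. Qed.
Lemma cImD z w : Im (z + w) = Im z + Im w. Proof. by case: z w => ? ? []. Qed.
Lemma cReN z : Re (- z) = - Re z. Proof. by case: z. Qed.
Lemma cImN z : Im (- z) = - Im z. Proof. by case: z. Qed.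
Lemma cReM z w : Re (z * w) = Re z * Re w - Im z * Im w. Proof. by case: z w => ? ? []. Qed.
Lemma cImM z w : Im (z * w) = Re z * Im w + Im z * Re w. Proof. by case: z w => ? ? []. Qed.

Lemma cmod_ge_Re z : `|Re z| <= cmod z.
Proof. by rewrite -sqrtr_sqr ler_wsqrtr// lerDl sqr_ge0. Qed.

Lemma cmod_ge_Im z : `|Im z| <= cmod z.
Proof. by rewrite -sqrtr_sqr ler_wsqrtr// lerDr sqr_ge0. Qed.

Lemma cmod_le z : cmod z <= `|Re z| + `|Im z|.
Proof.
rewrite -[leRHS]ger0_norm ?addr_ge0// -sqrtr_sqr ler_wsqrtr//.
rewrite sqrrD !real_normK ?num_real//.
by have := mulr_ge0 (normr_ge0 (Re z)) (normr_ge0 (Im z)); lra.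
Qed.

End cmod_theory.

(** * Entire functions and the complex exponential *)

Section holomorphic.

Lemma derivable_approxP (K : numFieldType) (f : K^o -> K^o) (z : K) :
  derivable f z 1 <-> exists l : K, forall e : K, 0 < e ->
    exists2 d, 0 < d & forall h, `|h| < d -> `|f (z + h) - f z - l * h| <= e * `|h|.
Proof.
split=> [df|[l Hl]].
  have /cvgrPdist_le D := df.
  exists ('D_1 f z) => e e0.
  have := D e e0; rewrite near_withinE => /nbhs_ballP[d /= d0 dD].
  exists d => // h hd; have [->|h0] := eqVneq h 0.
    by rewrite addr0 subrr mulr0 subrr normr0 mulr0.
  have := dD h; rewrite -ball_normE /= sub0r normrN => /(_ hd h0).
  rewrite [h *: 1]mulr1 (addrC h) -(ler_pM2r (x := `|h|)) ?normr_gt0// -normrM.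
  rewrite mulrBl [X in _ - X](_ : _ = f (z + h) - f z).
    by rewrite distrC.
  by rewrite /GRing.scale /= mulrAC mulVf// mul1r.
apply/cvg_ex; exists l; apply/cvgrPdist_le => e e0.
rewrite near_withinE; apply/nbhs_ballP.
have [d d0 H] := Hl e e0; exists d => //= h.
rewrite -ball_normE /= sub0r normrN => hd h0.
rewrite [h *: 1]mulr1 (addrC h) -(ler_pM2r (x := `|h|)) ?normr_gt0// -normrM.
rewrite mulrBl [X in _ - X](_ : _ = f (z + h) - f z); last first.
  by rewrite /GRing.scale /= mulrAC mulVf// mul1r.
by rewrite distrC; exact: H.
Qed.

Context {R : realType}.
Implicit Types (f g : R[i] -> R[i]) (z : R[i]).
Local Notation Re := (@complex.Re R).
Local Notation Im := (@complex.Im R).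

(** In [derivable_approxP] the tolerance and the radius are elements of [R[i]]; being positive they
    have zero imaginary part, so real ones can take their place. *)
Lemma cderivable_approxP f z : derivable (f : R[i]^o -> R[i]^o) z 1 <->
  exists l : R[i], forall e : R, 0 < e -> exists2 d : R, 0 < d &
    forall h : R[i], cmod h < d -> cmod (f (z + h) - f z - l * h) <= e * cmod h.
Proof.
split=> [/derivable_approxP[l H]|[l H]].
  exists l => e e0; have eC : 0 < e%:C :> R[i] by rewrite ltcR.
  have [d d0 {}H] := H _ eC.
  have dE : d = (Re d)%:C by rewrite RRe_real// ger0_real// ltW.
  exists (Re d); first by rewrite -ltcR -dE.
  move=> h hd; rewrite -lecR rmorphM/= -!normr_cmod; apply: H.
  by rewrite dE normr_cmod ltcR.
apply/derivable_approxP; exists l => e e0.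
have eE : e = (Re e)%:C by rewrite RRe_real// ger0_real// ltW.
have [|d d0 {}H] := H (Re e); first by rewrite -ltcR -eE.
exists d%:C; first by rewrite ltcR.
by move=> h; rewrite eE !normr_cmod ltcR -rmorphM/= lecR; exact: H.
Qed.

Lemma entire_approx f z : entire f -> exists l : R[i], forall e : R, 0 < e ->
  exists2 d : R, 0 < d &
    forall h : R[i], cmod h < d -> cmod (f (z + h) - f z - l * h) <= e * cmod h.
Proof. by move=> /(_ z) /cderivable_approxP. Qed.

Lemma entireM f g : entire f -> entire g -> entire (fun z => f z * g z).
Proof. by move=> ef eg z; apply: derivableM; [exact: ef|exact: eg]. Qed.

Lemma entire_comp f g : entire f -> entire g -> entire (fun z => f (g z)).
Proof.
move=> ef eg z; apply/derivable1_diffP.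
apply: (@differentiable_comp _ R[i]^o R[i]^o R[i]^o g f).
  exact/derivable1_diffP/eg.
exact/derivable1_diffP/ef.
Qed.

Lemma entire_cst (c : R[i]) : entire (fun=> c).
Proof. by move=> z; exact: derivable_cst. Qed.

Lemma entire_affine (a b : R[i]) : entire (fun z => a * z + b).
Proof.
move=> z; apply/cderivable_approxP; exists a => e e0; exists 1 => // h _.
rewrite (_ : _ - _ - _ = 0); last by ring.
by rewrite cmod0 mulr_ge0 ?cmod_ge0// ltW.
Qed.

(** Schwarz reflection: it provides the holomorphic factor that stands for the conjugate in |F|^2
    along a vertical line. *)
Lemma entire_conj f : entire f -> entire (fun z => cconj (f (cconj z))).
Proof.
move=> ef z; apply/cderivable_approxP.
have [l Hl] := entire_approx f (cconj z) ef.
exists (cconj l) => e e0; have [d d0 H] := Hl e e0; exists d => // h hd.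
have := H (cconj h); rewrite cmodJ => /(_ hd); congr (_ <= _).
rewrite -[LHS]cmodJ; congr cmod.
by rewrite !cconjE !(rmorphB, rmorphM, rmorphD)/= !conjcK.
Qed.

Lemma cexpD (z w : R[i]) : cexp (z + w) = cexp z * cexp w.
Proof.
case: z w => [a b] [c d]; rewrite /cexp /= expRD cosD sinD.
apply/eqP; rewrite eq_complex /=; apply/andP; split; apply/eqP; ring.
Qed.

Lemma cmod_cexp z : cmod (cexp z) = expR (Re z).
Proof.
rewrite /cexp cmodM cmod_real ger0_norm ?expR_ge0// /cmod /= cos2Dsin2.
by rewrite sqrtr1 mulr1.
Qed.

Lemma real_approx (g : R -> R) (l : R) : is_derive (0 : R) (1 : R) g l -> forall e, 0 < e ->
  exists2 d, 0 < d & forall x, `|x| < d -> `|g x - g 0 - l * x| <= e * `|x|.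
Proof.
move=> [dg gl] e e0; have /cvgrPdist_le /(_ e e0) := dg.
rewrite -/('D_1 g 0) gl near_withinE => /nbhs_ballP[d /= d0 dD].
exists d => // h hd; have [->|h0] := eqVneq h 0.
  by rewrite subrr mulr0 subrr normr0 mulr0.
have := dD h; rewrite -ball_normE /= sub0r normrN => /(_ hd h0).
rewrite [h *: 1]mulr1 addr0 -(ler_pM2r (x := `|h|)) ?normr_gt0// -normrM.
rewrite mulrBl [X in _ - X](_ : _ = g h - g 0).
  by rewrite distrC.
by rewrite /GRing.scale /= mulrAC mulVf// mul1r.
Qed.

Lemma entire_cexp : entire (@cexp R).
Proof.
move=> z; apply/cderivable_approxP; exists (cexp z) => e e0.
have k0 : 0 < cmod (cexp z) by rewrite cmod_cexp expR_gt0.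
(* By the addition formula only the remainder at 0 matters. The bounds [A1] to [A4] below contribute
   1, 2, 4 and 1 times r |h|, whence the 8; r <= 1 keeps factors such as 1 + x below 2. *)
pose r := Num.min 1 (e / cmod (cexp z) / 8).
have r0 : 0 < r by rewrite lt_min ltr01/= !divr_gt0.
have r1 : r <= 1 by rewrite ge_min lexx.
have re : 8 * r * cmod (cexp z) <= e.
  rewrite -ler_pdivlMr//.
  have : r <= e / cmod (cexp z) / 8 by rewrite ge_min lexx orbT.
  lra.
clearbody r.
have [d1 d10 H1] : exists2 d, 0 < d & forall x : R, `|x| < d -> `|expR x - 1 - x| <= r * `|x|.
  have D : is_derive (0 : R) (1 : R) expR 1.
    by have := is_derive_expR (0 : R); rewrite expR0.
  have [d d0 H] := real_approx expR 1 D r r0.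
  by exists d => // x /H; rewrite expR0 mul1r.
have [d2 d20 H2] : exists2 d, 0 < d & forall x : R, `|x| < d -> `|cos x - 1| <= r * `|x|.
  have D : is_derive (0 : R) (1 : R) cos 0.
    by have := is_derive_cos (0 : R); rewrite sin0 oppr0.
  have [d d0 H] := real_approx cos 0 D r r0.
  by exists d => // x /H; rewrite cos0 mul0r subr0.
have [d3 d30 H3] : exists2 d, 0 < d & forall x : R, `|x| < d -> `|sin x - x| <= r * `|x|.
  have D : is_derive (0 : R) (1 : R) sin 1.
    by have := is_derive_sin (0 : R); rewrite cos0.
  have [d d0 H] := real_approx sin 1 D r r0.
  by exists d => // x /H; rewrite sin0 mul1r subr0.
exists (Num.min r (Num.min d1 (Num.min d2 d3))); first by rewrite !lt_min r0 d10 d20.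
move=> h; rewrite !lt_min => /and4P[hr hd1 hd2 hd3].
rewrite cexpD (_ : _ - _ - _ = cexp z * (cexp h - 1 - h)); last by ring.
rewrite cmodM.
have hx := cmod_ge_Re h; have hy := cmod_ge_Im h.
have /H1 E1 := le_lt_trans hx hd1.
have /H2 E2 := le_lt_trans hy hd2.
have /H3 E3 := le_lt_trans hy hd3.
suff: cmod (cexp h - 1 - h) <= 8 * r * cmod h.
  move=> H; apply: (@le_trans _ _ (cmod (cexp z) * (8 * r * cmod h))).
    by rewrite ler_wpM2l// ltW.
  by rewrite mulrA ler_wpM2r ?cmod_ge0// mulrC.
case: h hr hd1 hd2 hd3 hx hy E1 E2 E3 => x y /= hr _ _ _ hx hy E1 E2 E3.
set m := cmod _ in hr hx hy *.
apply: (le_trans (cmod_le _)); rewrite /cexp !(cReD, cReN, cImD, cImN, cReM, cImM)/=.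
have -> : expR x * cos y - 0 * sin y - 1 - x =
  (expR x - 1 - x) * cos y + (1 + x) * (cos y - 1) by ring.
have -> : expR x * sin y + 0 * cos y - 0 - y =
  (expR x - 1) * sin y + (sin y - y) by ring.
have A1 : `|(expR x - 1 - x) * cos y| <= r * m.
  rewrite normrM -[leRHS]mulr1 ler_pM//; last by rewrite ler_norml cos_geN1 cos_le1.
  by rewrite (le_trans E1)// ler_wpM2l// ltW.
have A2 : `|(1 + x) * (cos y - 1)| <= 2 * (r * m).
  rewrite normrM ler_pM//; last by rewrite (le_trans E2)// ler_wpM2l// ltW.
  by rewrite (le_trans (ler_normD _ _))// normr1; lra.
have A3 : `|(expR x - 1) * sin y| <= r * (4 * m).
  rewrite normrM (_ : r * (4 * m) = (2 * r) * (2 * m)); last by ring.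
  apply: ler_pM => //.
    rewrite -[_ - 1](subrK x) (le_trans (ler_normD _ _))//.
    have : r * `|x| <= 1 * `|x| by rewrite ler_wpM2r.
    lra.
  rewrite -[sin y](subrK y) (le_trans (ler_normD _ _))//.
  have : r * `|y| <= 1 * `|y| by rewrite ler_wpM2r.
  lra.
have A4 : `|sin y - y| <= r * m by rewrite (le_trans E3)// ler_wpM2l// ltW.
apply: (le_trans (lerD (ler_normD _ _) (ler_normD _ _))); lra.
Qed.

Lemma entire_linear (k : R[i]) : entire (fun z => k * z).
Proof.
have := entire_affine k 0; rewrite [X in entire X -> _](_ : _ = (fun z => k * z))//.
by apply/funext => z; rewrite addr0.
Qed.

Lemma entire_kernel (w : R[i]) : entire (fock_kernel w).
Proof. exact: (entire_comp _ _ entire_cexp (entire_linear (cconj w))). Qed.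

Lemma entire_continuous f z : entire f -> forall e : R, 0 < e -> exists2 d : R, 0 < d &
  forall h, cmod h < d -> cmod (f (z + h) - f z) < e.
Proof.
move=> ef e e0; have [l /(_ 1 ltr01)[d d0 H]] := entire_approx f z ef.
have k0 : 0 < cmod l + 1 by rewrite ltr_wpDl ?cmod_ge0.
exists (Num.min d (e / (cmod l + 1))); first by rewrite lt_min d0 divr_gt0.
move=> h; rewrite lt_min ltr_pdivlMr// => /andP[hd he].
rewrite -[f _ - f z](subrK (l * h)) (le_lt_trans (cmodD _ _))// cmodM.
by have := H h hd; lra.
Qed.

Lemma entire_continuous2 f : entire f ->
  continuous (fun p : R * R => cmod (f (p.1 +i* p.2)) ^+ 2).
Proof.
move=> ef p; rewrite /continuous_at expr2.
under eq_fun do rewrite expr2.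
suff H : cmod (f (q.1 +i* q.2)) @[q --> p] --> cmod (f (p.1 +i* p.2)) by exact: cvgM.
apply/cvgrPdist_lt => e e0.
have [d d0 Hd] := entire_continuous f (p.1 +i* p.2) ef e e0.
have d2 : 0 < d / 2 by rewrite divr_gt0.
have c1 : \forall q \near p, `|p.1 - q.1| < d / 2 
  by have /cvgrPdist_lt/(_ _ d2) : q.1 @[q --> p] --> p.1 by case: p {d d0 Hd d2} => ? ?; exact: cvg_fst.
have c2 : \forall q \near p, `|p.2 - q.2| < d / 2 
  by have /cvgrPdist_lt/(_ _ d2) : q.2 @[q --> p] --> p.2 by case: p {d d0 Hd d2 c1} => ? ?; exact: cvg_snd.
near=> q.
have q1 : `|p.1 - q.1| < d / 2 by near: q.
have q2 : `|p.2 - q.2| < d / 2 by near: q.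
have := Hd ((q.1 - p.1) +i* (q.2 - p.2)).
rewrite (_ : p.1 +i* p.2 + _ = q.1 +i* q.2); last first.
  by apply/eqP; rewrite eq_complex cReD cImD /= ![_ + (_ - _)]addrC !subrK !eqxx.
have -> : cmod ((q.1 - p.1) +i* (q.2 - p.2)) < d.
  by rewrite (le_lt_trans (cmod_le _))//= distrC [`|q.2 - _|]distrC; lra.
move=> /(_ isT); set u := f _; set v := f _ => uv; rewrite ltr_norml; apply/andP; split.
  have := cmodD v (u - v); rewrite [v + _]addrC subrK; lra.
have := cmodD u (v - u); rewrite [u + _]addrC subrK -[v - u]opprB cmodN; lra.
Unshelve. all: by end_near. Qed.

End holomorphic.

(** If B dropped by del > 0 between s1 and s2, midpoint convexity would make B grow by at least del
    at each further step of length s2 - s1 to the left, against the bound near -oo. *)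
Lemma midpoint_convex_nondecreasing {R : realType} (B : R -> R) :
  (forall s t, 0 <= t -> B s <= (B (s - t) + B (s + t)) / 2) ->
  (exists s0 K, forall s, s <= s0 -> B s <= K) ->
  {homo B : s1 s2 / s1 <= s2}.
Proof.
move=> mid [s0 [K bnd]] s1 s2.
rewrite le_eqVlt => /predU1P[->//|s12]; rewrite leNgt; apply/negP => lt12.
pose tau := s2 - s1; have tau0 : 0 < tau by rewrite subr_gt0.
pose a n := B (s2 - n%:R * tau).
have {}mid n : a n.+1 <= (a n.+2 + a n) / 2.
  have := mid (s2 - n.+1%:R * tau) tau (ltW tau0).
  rewrite (_ : _ - tau = s2 - n.+2%:R * tau); last by rewrite -[n.+2]addn1 natrD; ring.
  by rewrite (_ : _ + tau = s2 - n%:R * tau)//; rewrite -[n.+1]addn1 natrD; ring.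
have a1 : a 1%N = B s1 by rewrite /a mul1r /tau opprB [s2 + _]addrC subrK.
have a0 : a 0%N = B s2 by rewrite /a mul0r subr0.
move: lt12; rewrite -a1 -a0 -subr_gt0; set del := a 1%N - a 0%N => del0.
have step n : del <= a n.+1 - a n.
  by elim: n => [|n IH] //; have := mid n; lra.
have grow n : a 0%N + n%:R * del <= a n.
  elim: n => [|n IH]; first by rewrite mul0r addr0.
  by have := step n; rewrite -[n.+1]addn1 natrD mulrDl addn1; lra.
(* Enough steps both to get left of [s0] and to climb above [K]. *)
pose n := maxn (Num.trunc (`|s2 - s0| / tau)).+1 (Num.trunc (`|K - a 0%N| / del)).+1.
have n1 : `|s2 - s0| / tau < n%:R.
  by apply: (lt_le_trans (truncnS_gt _)); rewrite ler_nat leq_maxl.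
have n2 : `|K - a 0%N| / del < n%:R.
  by apply: (lt_le_trans (truncnS_gt _)); rewrite ler_nat leq_maxr.
rewrite ltr_pdivrMr// in n1; rewrite ltr_pdivrMr// in n2.
have sn : s2 - n%:R * tau <= s0 by have := ler_norm (s2 - s0); lra.
have an : a n <= K := bnd _ sn.
have := grow n; have := ler_norm (K - a 0%N); lra.
Qed.

(** * Circle integrals of |f|^2 as functions of the logarithm of the radius *)

Section circle_mean.
Context {R : realType}.
Implicit Types (f : R[i] -> R[i]) (z : R[i]) (s t : R).
Local Notation Re := (@complex.Re R).
Local Notation Im := (@complex.Im R).

(** The form is Im (H dz) = Im H ds + Re H dt, and the Cauchy-Riemann equations make the cross
    coefficients agree. The imaginary part is taken because it puts Re H on the vertical sides. *)
Lemma entire_closed_form (H : R[i] -> R[i]) : entire H -> forall s t,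
  closed_form_at (fun s t => Im (H (s +i* t))) (fun s t => Re (H (s +i* t))) s t.
Proof.
move=> eH s0 t0; have [l Hl] := entire_approx H (s0 +i* t0) eH.
exists (Im l), (Re l), (- Im l) => e e0; have [d d0 {}Hl] := Hl e e0.
exists (d / 2); first by rewrite divr_gt0.
move=> s t sd td; pose h := (s - s0) +i* (t - t0).
have hle := cmod_le h.
have hd : cmod h < d by rewrite (le_lt_trans hle)//=; lra.
have hE : s0 +i* t0 + h = s +i* t.
  by apply/eqP; rewrite eq_complex cReD cImD /= ![_ + (_ - _)]addrC !subrK !eqxx.
have := Hl h hd; rewrite hE; set u := H _; set v := H _ => uv.
have {}uv : cmod (u - v - l * h) <= e * (`|s - s0| + `|t - t0|).
  by rewrite (le_trans uv)// ler_wpM2l// ltW.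
split.
  apply: le_trans uv; apply: le_trans (cmod_ge_Im _).
  rewrite !(cImD, cImN, cImM) /h /=.
  by rewrite le_eqVlt; apply/orP; left; apply/eqP; congr `|_|; ring.
apply: le_trans uv; apply: le_trans (cmod_ge_Re _).
rewrite !(cReD, cReN, cReM) /h /=.
by rewrite le_eqVlt; apply/orP; left; apply/eqP; congr `|_|; ring.
Qed.

Notation twopi := (pi *+ 2 : R).

Lemma twopi_ge0 : 0 <= twopi. Proof. by rewrite mulrn_wge0// pi_ge0. Qed.

(** Around a rectangle of height 2 pi the two horizontal sides cancel by periodicity. *)
Lemma periodic_contour_shift (H : R[i] -> R[i]) : entire H ->
  (forall s t, H (s +i* (t + twopi)) = H (s +i* t)) ->
  forall s1 s2, s1 <= s2 ->
  segint (fun t => Re (H (s1 +i* t))) 0 twopi = segint (fun t => Re (H (s2 +i* t))) 0 twopi.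
Proof.
move=> eH pH s1 s2 s12.
have s120 : 0 <= s2 - s1 by rewrite subr_ge0.
have := goursat_rectangle _ _ (entire_closed_form H eH) s1 0 (s2 - s1) twopi s120 twopi_ge0.
rewrite [s1 + _]addrC subrK add0r.
rewrite (_ : (fun s => Im (H (s +i* twopi))) = (fun s => Im (H (s +i* 0)))); last first.
  by apply/funext => s; rewrite -[twopi]add0r pH.
by move=> /eqP; rewrite subr_eq0 addrAC subrr add0r => /eqP.
Qed.

(** The factor z lets the circle pass through a prescribed point: at s = 0 it is the orbit of z
    under rotations. The integral is not divided by 2 pi. *)
Definition circle_mean f z s : R :=
  segint (fun t => cmod (f (cexp (s +i* t) * z)) ^+ 2) 0 twopi.

Lemma entire_exp_scale f z : entire f -> entire (fun w => f (cexp w * z)).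
Proof.
move=> ef.
exact: (entire_comp f _ ef (entireM (@cexp R) (fun=> z) entire_cexp (entire_cst z))).
Qed.

Lemma entire_continuous_sqr f z : entire f -> forall e : R, 0 < e -> exists2 d : R, 0 < d &
  forall h, cmod h < d -> `|cmod (f (z + h)) ^+ 2 - cmod (f z) ^+ 2| <= e.
Proof.
move=> ef e e0; pose k := 2 * cmod (f z) + 1.
have k0 : 0 < k by rewrite ltr_wpDl// mulr_ge0// cmod_ge0.
pose r := Num.min 1 (e / k).
have r0 : 0 < r by rewrite lt_min ltr01 divr_gt0.
have r1 : r <= 1 by rewrite ge_min lexx.
have rk : r * k <= e by rewrite -ler_pdivlMr// ge_min lexx orbT.
clearbody r.
have [d d0 H] := entire_continuous f z ef r r0; exists d => // h /H.
set u := f (z + h); set v := f z => uv.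
have h1 := cmodD v (u - v); have h2 := cmodD u (v - u).
rewrite [v + _]addrC subrK in h1; rewrite [u + _]addrC subrK -[v - u]opprB cmodN in h2.
have u0 := cmod_ge0 u; have v0 := cmod_ge0 v.
rewrite subr_sqr normrM; apply: le_trans rk; apply: ler_pM => //.
  by rewrite ler_norml; apply/andP; split; lra.
by rewrite ger0_norm ?addr_ge0// /k -/v; lra.
Qed.

Lemma entire_continuous_vertical (F : R[i] -> R[i]) s : entire F ->
  continuous (fun t => cmod (F (s +i* t)) ^+ 2).
Proof.
move=> eF t; apply/cvgrPdist_le => e e0.
have [d d0 H] := entire_continuous_sqr F (s +i* t) eF e e0.
near=> x.
have xd : `|t - x| < d by near: x; exact: cvgr_dist_lt.
have := H (0 +i* (x - t)).
rewrite (_ : s +i* t + _ = s +i* x); last first.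
  by apply/eqP; rewrite eq_complex cReD cImD /= addr0 [_ + (_ - _)]addrC subrK !eqxx.
rewrite distrC; apply.
by rewrite (le_lt_trans (cmod_le _))//= normr0 add0r distrC.
Unshelve. all: by end_near. Qed.

Lemma cexp_periodic s t : cexp (s +i* (t + twopi)) = cexp (s +i* t).
Proof. by rewrite /cexp /= cosD2pi sinD2pi. Qed.

(* With F w = f (e^w z), the function H w = F w * conj (F (2 s - conj w)) is
   entire and 2 i pi-periodic, and equals |F|^2 on the line Re w = s. *)
Lemma circle_mean_midpoint f z s tau : entire f -> 0 <= tau ->
  circle_mean f z s <= (circle_mean f z (s - tau) + circle_mean f z (s + tau)) / 2.
Proof.
move=> ef tau0; pose F w := f (cexp w * z).
have eF : entire F by exact: entire_exp_scale.
pose G w := cconj (F (cconj w)).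
pose H w := F w * G (-1 * w + (2 * s)%:C).
have eH : entire H.
  exact: (entireM F _ eF (entire_comp G _ (entire_conj F eF) (entire_affine (-1) (2 * s)%:C))).
have HE x t : H (x +i* t) = F (x +i* t) * cconj (F ((2 * s - x) +i* t)).
  rewrite /H /G; congr (_ * cconj (F _)).
  by apply/eqP; rewrite /cconj eq_complex !(cReD, cReM, cImD, cImM) /=; apply/andP; split; apply/eqP; ring.
have pH x t : H (x +i* (t + twopi)) = H (x +i* t).
  by rewrite !HE /F !cexp_periodic.
have -> : circle_mean f z s = segint (fun t => Re (H (s +i* t))) 0 twopi.
  congr segint; apply/funext => t; rewrite HE (_ : 2 * s - s = s); last by ring.
  by rewrite -cmod_sqrC.
(* On the line Re w = s + tau, H pairs the values of F over s + tau and s - tau, and Re (u conj v)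
   <= (|u|^2 + |v|^2) / 2. *)
rewrite (periodic_contour_shift H eH pH s (s + tau)) ?lerDl//.
have cF x := entire_continuous_vertical F x eF.
have cH x : continuous (fun t => Re (H (x +i* t))).
  by apply: (closed_form_continuous2 _ _ (entire_closed_form H eH)).
pose g (t : R) := 2^-1 * (cmod (F ((s - tau) +i* t)) ^+ 2) + 2^-1 * (cmod (F ((s + tau) +i* t)) ^+ 2).
have cM x : continuous (fun t => 2^-1 * cmod (F (x +i* t)) ^+ 2).
  by move=> t; apply: cvgM; [exact: cvg_cst|exact: cF].
apply: (@le_trans _ _ (segint g 0 twopi)).
  apply: le_segint => // [t|t _]; first by apply: cvgD; exact: cM.
  rewrite /g HE (_ : 2 * s - (s + tau) = s - tau); last by ring.
  set u := F _; set v := F _; rewrite !cmod_sqr cReM /=.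
  have := sqr_ge0 (Re u - Re v); have := sqr_ge0 (Im u - Im v); rewrite !sqrrB; lra.
rewrite /g /segint RintegralD//; [|exact: integrable_segment..].
rewrite !RintegralZl//; [|exact: integrable_segment..].
by rewrite -mulrDr mulrC.
Qed.

Lemma segint_cst (k : R) : segint (fun=> k) 0 twopi = k * twopi.
Proof.
have := segint_affine k 0 0 twopi twopi_ge0.
rewrite subr0 !mul0r addr0 => <-; congr segint; apply/funext => x.
by rewrite mul0r addr0.
Qed.

Lemma circle_mean_near0 f z e : entire f -> 0 < e -> exists s0 : R, forall s, s <= s0 ->
  (cmod (f 0) ^+ 2 - e) * twopi <= circle_mean f z s <= (cmod (f 0) ^+ 2 + e) * twopi.
Proof.
move=> ef e0; have [d d0 H] := entire_continuous_sqr f 0 ef e e0.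
have k0 : 0 < cmod z + 1 by rewrite ltr_wpDl// cmod_ge0.
(* Chosen so that |e^w z| < d on the line Re w = s; adding 1 to |z| covers z = 0. *)
exists (ln (d / (cmod z + 1))) => s.
rewrite -ler_expR lnK ?posrE ?divr_gt0// ler_pdivlMr// => sd.
have cF := entire_continuous_vertical _ s (entire_exp_scale f z ef).
have close t : `|cmod (f (cexp (s +i* t) * z)) ^+ 2 - cmod (f 0) ^+ 2| <= e.
  rewrite -[cexp _ * z]add0r; apply: H.
  by rewrite cmodM cmod_cexp /= (lt_le_trans _ sd)// ltr_pM2l ?expR_gt0// ltrDl.
rewrite -!segint_cst; apply/andP; split; apply: le_segint => //;
  try (by move=> x; exact: cvg_cst); move=> t _;
  by have := close t; rewrite ler_norml => /andP[]; lra.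
Qed.

Lemma circle_mean_nondecreasing f z s1 s2 : entire f -> s1 <= s2 ->
  circle_mean f z s1 <= circle_mean f z s2.
Proof.
move=> ef; apply: midpoint_convex_nondecreasing => [s tau|].
  exact: circle_mean_midpoint.
have [s0 H] := circle_mean_near0 f z 1 ef ltr01.
by exists s0, ((cmod (f 0) ^+ 2 + 1) * twopi) => s /H/andP[].
Qed.

(** The left side is the limit of the circle integral as s tends to -oo. It serves the dilation by
    0, which has no logarithmic radius. *)
Lemma circle_mean_center f z s : entire f ->
  cmod (f 0) ^+ 2 * twopi <= circle_mean f z s.
Proof.
move=> ef; apply/ler_addgt0Pr => e e0.
have p0 : 0 < twopi by rewrite pmulrn_lgt0// pi_gt0.
have [s0 H] := circle_mean_near0 f z (e / twopi) ef (divr_gt0 e0 p0).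
have ms0 : Num.min s0 s <= s0 by rewrite ge_min lexx.
have ms : Num.min s0 s <= s by rewrite ge_min lexx orbT.
have /andP[+ _] := H _ ms0.
rewrite mulrBl mulfVK ?gt_eqF// lerBlDr => /le_trans; apply.
by rewrite lerD2r; exact: circle_mean_nondecreasing.
Qed.

Lemma circle_mean_scale f z r : entire f -> 0 <= r <= 1 ->
  segint (fun t => cmod (f (r%:C * (cexp (0 +i* t) * z))) ^+ 2) 0 twopi <= circle_mean f z 0.
Proof.
move=> ef /andP[]; rewrite le_eqVlt => /predU1P[<- _|r0 r1].
  rewrite [X in segint X](_ : _ = fun=> cmod (f 0) ^+ 2).
    by rewrite segint_cst circle_mean_center.
  by apply/funext => t; rewrite mul0r.
rewrite [X in segint X](_ : _ = fun t => cmod (f (cexp (ln r +i* t) * z)) ^+ 2).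
  by apply: (circle_mean_nondecreasing f z (ln r) 0) => //; exact: ln_le0.
apply/funext => t; rewrite mulrA; congr (cmod (f (_ * z)) ^+ 2).
by rewrite /cexp /= expR0 mul1r lnK.
Qed.

End circle_mean.

(** * The Fock norm under rotations, dilations and Weyl operators *)

Section fock_space.
Context {R : realType}.
Implicit Types (f g : R[i] -> R[i]) (a b c r u v w z : R[i]) (p : R * R).
Local Notation Re := (@complex.Re R).
Local Notation Im := (@complex.Im R).
Notation mu := (@lebesgue_measure R).
Notation twopi := (pi *+ 2 : R).
Notation mod2 f := (fun p : R * R => cmod (f (p.1 +i* p.2)) ^+ 2).

Lemma fock_weight_ge0 p : 0 <= fock_weight p.
Proof. by rewrite divr_ge0 ?expR_ge0 ?pi_ge0. Qed.

Lemma measurable_fock_weight : measurable_fun setT (@fock_weight R).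
Proof.
rewrite /fock_weight; apply: measurable_funM => //.
have -> : (fun p : R * R => expR (- (p.1 ^+ 2 + p.2 ^+ 2))) =
    expR \o (fun p : R * R => - (p.1 ^+ 2 + p.2 ^+ 2)) by [].
apply: measurableT_comp => //; apply: measurableT_comp => //.
by apply: measurable_funD; exact: measurable_funX.
Qed.

Lemma measurable_mod2 f : entire f -> measurable_fun setT (mod2 f).
Proof. by move=> ef; apply: continuous_measurable_fun2; exact: entire_continuous2. Qed.

Lemma measurable_fock_density f : entire f ->
  measurable_fun setT (fun p => (mod2 f p * fock_weight p)%:E).
Proof.
move=> ef; apply/measurable_EFinP; apply: measurable_funM.
  exact: measurable_mod2.
exact: measurable_fock_weight.
Qed.

Lemma fock_density_ge0 f p : (0 <= (mod2 f p * fock_weight p)%:E)%E.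
Proof. by rewrite lee_fin mulr_ge0 ?sqr_ge0 ?fock_weight_ge0. Qed.

Lemma fock_norm2_ge0 f : (0 <= fock_norm2 f)%E.
Proof. by apply: integral_ge0 => p _; exact: fock_density_ge0. Qed.

Lemma fock_norm2_scale (k : R[i]) f : entire f ->
  fock_norm2 (fun z => k * f z) = ((cmod k ^+ 2)%:E * fock_norm2 f)%E.
Proof.
move=> ef; rewrite /fock_norm2 -ge0_integralZl//.
- by apply: eq_integral => p _; rewrite cmodM exprMn -mulrA EFinM.
- exact: measurable_fock_density.
- by move=> p _; exact: fock_density_ge0.
- by rewrite lee_fin sqr_ge0.
Qed.

Lemma fock_norm2_rotation u f : entire f -> cmod u = 1 ->
  fock_norm2 (fun z => f (u * z)) = fock_norm2 f.
Proof.
move=> ef u1.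
have cs : Re u ^+ 2 + Im u ^+ 2 = 1 by rewrite -cmod_sqr u1 expr1n.
rewrite /fock_norm2 -[RHS](ge0_integral_rotation _ _ _ cs (measurable_fock_density f ef))//.
  apply: eq_integral => p _ /=; congr ((cmod (f _) ^+ 2 * (expR (- _) / pi))%:E).
    by apply/eqP; rewrite eq_complex cReM cImM /= [X in _ && (_ == X)]addrC !eqxx.
  transitivity ((Re u ^+ 2 + Im u ^+ 2) * (p.1 ^+ 2 + p.2 ^+ 2)); last by rewrite /=; ring.
  by rewrite cs mul1r.
by move=> p; exact: fock_density_ge0.
Qed.

Lemma integral_indic_segint (h : R -> R) (a b : R) : continuous h ->
  (\int[mu]_t (\1_(`[a, b]%classic : set R) t * h t)%:E)%E = (segint h a b)%:E.
Proof.
move=> ch; rewrite /segint /Rintegral fineK; last first.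
  exact: (integrable_fin_num _ (integrable_segment h a b ch)).
rewrite [RHS]integral_mkcond; apply: eq_integral => t _.
by rewrite patchE indicE; case: ifPn => _; rewrite ?mul1r ?mul0r.
Qed.

Lemma continuous_rotate f r z : entire f ->
  continuous (fun t => cmod (f (r * (cexp (0 +i* t) * z))) ^+ 2).
Proof.
move=> ef.
have eF : entire (fun w => f (r * (cexp w * z))).
  apply: (entire_exp_scale (fun w => f (r * w))).
  exact: (entire_comp f _ ef (entire_linear r)).
exact: (entire_continuous_vertical _ 0 eF).
Qed.

Definition circle_integral f r (p : R * R) : R :=
  segint (fun t => cmod (f (r * (cexp (0 +i* t) * (p.1 +i* p.2)))) ^+ 2) 0 twopi.

(** All rotates of f (r .) have the same norm, so integrating the norm over the angle gives the
    factor 2 pi, and Tonelli moves the angular integral inside. Measurability is part of the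
    conclusion because the comparison of two such integrals needs it. *)
Lemma fock_norm2_circle f r : entire f ->
  measurable_fun setT (fun p => (fock_weight p * circle_integral f r p)%:E) /\
  (twopi%:E * fock_norm2 (fun z => f (r * z)%R) =
  \int[mu \x mu]_p (fock_weight p * circle_integral f r p)%:E)%E.
Proof.
move=> ef.
have efr : entire (fun z => f (r * z)).
  exact: (entire_comp f _ ef (entire_linear r)).
pose I : set R := `[0, twopi]%classic.
pose F (q : R * (R * R)) : \bar R :=
  (\1_I q.1 * (fock_weight q.2 *
    cmod (f (r * (cexp (0 +i* q.1) * (q.2.1 +i* q.2.2)))) ^+ 2))%:E.
have mI : measurable_fun setT (\1_I : R -> R) by apply: measurable_indic; exact: measurable_itv.
have muI : mu I = twopi%:E.
  rewrite lebesgue_measure_itv/= lte_fin pmulrn_lgt0// pi_gt0.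
  by rewrite -EFinD subr0.
have F0 q : (0 <= F q)%E.
  by rewrite lee_fin mulr_ge0// mulr_ge0 ?sqr_ge0 ?fock_weight_ge0.
have mF : measurable_fun setT F.
  have mw : measurable_fun setT (fun q : R * (R * R) => fock_weight q.2).
    by apply: (@measurableT_comp _ _ _ _ _ _ (@fock_weight R)) => //; exact: measurable_fock_weight.
  have mI1 : measurable_fun setT (fun q : R * (R * R) => \1_I q.1 : R).
    by apply: (@measurableT_comp _ _ _ _ _ _ (\1_I : R -> R)).
  apply/measurable_EFinP; apply: measurable_funM => //; apply: measurable_funM => //.
  (* Joint measurability in angle and point: the integrand is a continuous function of the rotated
     point, composed with this measurable map. *)
  pose rot (q : R * (R * R)) : R * R :=
    (cos q.1 * q.2.1 - sin q.1 * q.2.2, cos q.1 * q.2.2 + sin q.1 * q.2.1).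
  have mrot : measurable_fun setT rot.
    have mc : measurable_fun setT (fun q : R * (R * R) => cos q.1).
      by apply: measurableT_comp => //; apply: continuous_measurable_fun; exact: continuous_cos.
    have ms : measurable_fun setT (fun q : R * (R * R) => sin q.1).
      by apply: measurableT_comp => //; apply: continuous_measurable_fun; exact: continuous_sin.
    have mx : measurable_fun setT (fun q : R * (R * R) => q.2.1) by exact: measurableT_comp.
    have my : measurable_fun setT (fun q : R * (R * R) => q.2.2) by exact: measurableT_comp.
    apply: measurable_fun_pair.
      by apply: measurable_funB; apply: measurable_funM.
    by apply: measurable_funD; apply: measurable_funM.
  rewrite [X in measurable_fun _ X](_ : _ = mod2 (fun z => f (r * z)) \o rot).
    exact: (measurableT_comp (measurable_mod2 _ efr) mrot).
  apply/funext => q /=; congr (cmod (f (r * _)) ^+ 2).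
  by rewrite /cexp /= expR0 mul1r; apply/eqP; rewrite eq_complex cReM cImM/= !eqxx.
have FE p : (\int[mu]_t F (t, p) = (fock_weight p * circle_integral f r p)%:E)%E.
  rewrite EFinM /circle_integral -integral_indic_segint; last exact: continuous_rotate.
  rewrite -ge0_integralZl//.
  - by apply: eq_integral => t _; rewrite /F /= mulrCA EFinM.
  - apply/measurable_EFinP; apply: measurable_funM => //.
    by apply: continuous_measurable_fun; exact: continuous_rotate.
  - by move=> t _; rewrite lee_fin mulr_ge0// sqr_ge0.
  - by rewrite lee_fin fock_weight_ge0.
have FE' t : (\int[mu \x mu]_p F (t, p) = (\1_I t)%:E * fock_norm2 (fun z => f (r * z)%R))%E.
  rewrite -(fock_norm2_rotation (cexp (0 +i* t)) _ efr); last by rewrite cmod_cexp expR0.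
  rewrite /fock_norm2 -ge0_integralZl//.
  - by apply: eq_integral => p _; rewrite /F /= EFinM [X in (_ * X%:E)%E]mulrC.
  - exact: (measurable_fock_density _ (entire_comp (fun z => f (r * z)) _ efr
      (entire_linear (cexp (0 +i* t))))).
  - by move=> p _; exact: (fock_density_ge0 (fun z => f (r * (cexp (0 +i* t) * z)))).
split.
  have := measurable_lebesgue_tonelli3 F mF F0.
  by under eq_fun do rewrite FE.
transitivity (\int[mu]_t \int[mu \x mu]_p F (t, p))%E.
  under eq_integral do rewrite FE'.
  rewrite ge0_integralZr//; last exact: fock_norm2_ge0.
    rewrite integral_indic//; last exact: measurable_itv.
    set X := I `&` _; have -> : X = I by apply/seteqP; split => [t []|t It].
    by rewrite -muI.
  exact/measurable_EFinP.
rewrite lebesgue_tonelli3//.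
by apply: eq_integral => p _; exact: FE.
Qed.

Lemma circle_integral_ge0 f r p : 0 <= circle_integral f r p.
Proof. by apply: Rintegral_ge0 => t _; exact: sqr_ge0. Qed.

Lemma fock_norm2_dilation f a : entire f -> cmod a <= 1 ->
  (fock_norm2 (fun z => f (a * z)%R) <= fock_norm2 f)%E.
Proof.
move=> ef a1.
have real_case (r : R) : 0 <= r <= 1 -> (fock_norm2 (fun z => f (r%:C * z)%R) <= fock_norm2 f)%E.
  move=> r01; have p0 : 0 < twopi by rewrite pmulrn_lgt0 ?pi_gt0.
  (* After multiplication by 2 pi both sides are plane integrals of circle integrals, which
     [circle_mean_scale] compares at each point. *)
  rewrite -(lee_pmul2l (x := twopi%:E)) ?lte_fin//.
  have -> : fock_norm2 f = fock_norm2 (fun z => f (1 * z)).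
    by congr fock_norm2; apply/funext => z; rewrite mul1r.
  have [m1 ->] := fock_norm2_circle f r%:C ef.
  have [m2 ->] := fock_norm2_circle f 1 ef.
  apply: ge0_le_integral => //.
  - by move=> p _; rewrite lee_fin mulr_ge0 ?circle_integral_ge0 ?fock_weight_ge0.
  - move=> p _; rewrite lee_fin ler_wpM2l ?fock_weight_ge0//.
    rewrite [leRHS](_ : _ = circle_mean f (p.1 +i* p.2) 0); first exact: circle_mean_scale.
    by congr segint; apply/funext => t; rewrite mul1r.
have [->|a0] := eqVneq a 0; first by apply: (real_case 0); rewrite lexx ler01.
have na0 : cmod a != 0 by rewrite cmod_eq0.
(* Polar decomposition: the unimodular factor is a rotation and preserves the norm. *)
pose u := a / (cmod a)%:C.
have naC : (cmod a)%:C != 0 :> R[i] by rewrite -[0]/(0%:C) (inj_eq (@complexI R)).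
have aE : a = (cmod a)%:C * u by rewrite /u mulrCA divff ?mulr1.
rewrite {1}aE.
have -> : (fun z => f ((cmod a)%:C * u * z)) = (fun z => (fun y => f ((cmod a)%:C * y)) (u * z)).
  by apply/funext => z; rewrite mulrA.
rewrite (fock_norm2_rotation u (fun y => f ((cmod a)%:C * y))).
- by apply: real_case; rewrite cmod_ge0.
- exact: (entire_comp f _ ef (entire_linear (cmod a)%:C)).
- by rewrite /u cmodM cmodV cmod_real ger0_norm ?cmod_ge0// divff.
Qed.

(** The exponential factor is the normalized reproducing kernel at u. *)
Definition weyl u f z := cexp (cconj u * z - (cmod u ^+ 2 / 2)%:C) * f (z - u).

Lemma entire_weyl u f : entire f -> entire (weyl u f).
Proof.
move=> ef.
have shift_u : entire (fun z => z - u).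
  have := entire_affine 1 (- u); rewrite [X in entire X -> _](_ : _ = (fun z => z - u))//.
  by apply/funext => z; rewrite mul1r.
exact: (entireM _ _ (entire_comp (@cexp R) _ entire_cexp
  (entire_affine (cconj u) (- (cmod u ^+ 2 / 2)%:C))) (entire_comp f _ ef shift_u)).
Qed.

(** The squared modulus of the exponential factor turns e^(-|z|^2) into e^(-|z - u|^2), which leaves
    a translation of the plane. *)
Lemma fock_norm2_weyl u f : entire f -> fock_norm2 (weyl u f) = fock_norm2 f.
Proof.
move=> ef; rewrite /fock_norm2.
rewrite -[RHS](ge0_integral_translation2 (- Re u) (- Im u) _ (measurable_fock_density f ef)); last first.
  by move=> p; exact: fock_density_ge0.
apply: eq_integral => p _; congr EFin; rewrite /weyl cmodM exprMn cmod_cexp.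
rewrite (_ : p.1 +i* p.2 - u = (p.1 - Re u) +i* (p.2 - Im u)); last first.
  by apply/eqP; rewrite eq_complex !(cReD, cImD, cReN, cImN)/= !eqxx.
rewrite mulrAC mulrC; congr (_ * _).
rewrite /fock_weight mulrA -expRM_natl -expRD; congr (expR _ / _).
by rewrite !(cReD, cReN, cReM)/= cmod_sqr; field.
Qed.

Lemma fock_norm2_cst1 : fock_norm2 (fun=> 1 : R[i]) = 1%E.
Proof.
have := measurable_fock_density _ (entire_cst (1 : R[i])).
rewrite /fock_norm2 cmod1 expr1n => m1.
rewrite lebesgue_tonelli1//; last by move=> p; rewrite lee_fin mul1r fock_weight_ge0.
have mg : measurable_fun setT (EFin \o @gauss_fun R).
  by apply/measurable_EFinP; exact: measurable_gauss_fun.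
have g0 x : (0 <= (@gauss_fun R x)%:E)%E by rewrite lee_fin gauss_fun_ge0.
transitivity (\int[mu]_x ((gauss_fun x * pi^-1)%:E * (Num.sqrt pi)%:E))%E.
  apply: eq_integral => x _; rewrite -integralT_gauss -ge0_integralZl//.
    apply: eq_integral => y _; rewrite -EFinM; congr EFin.
    by rewrite mul1r /fock_weight /gauss_fun/= opprD expRD; ring.
  by rewrite lee_fin mulr_ge0 ?gauss_fun_ge0// invr_ge0 pi_ge0.
transitivity (\int[mu]_x ((pi^-1 * Num.sqrt pi)%:E * (gauss_fun x)%:E))%E.
  by apply: eq_integral => x _; rewrite -!EFinM; congr EFin; ring.
rewrite ge0_integralZl//; last by rewrite lee_fin mulr_ge0 ?sqrtr_ge0// invr_ge0 pi_ge0.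
rewrite integralT_gauss -EFinM -mulrA -expr2 sqr_sqrtr ?pi_ge0// mulVf//.
by rewrite gt_eqF// pi_gt0.
Qed.

End fock_space.

(** * The operator norm, computed on kernels and bounded by factorization *)

Section weighted_composition.
Context {R : realType}.
Implicit Types (f g : R[i] -> R[i]) (a b c k u v w z : R[i]).
Local Notation Re := (@complex.Re R).
Local Notation Im := (@complex.Im R).

(** The kernel is e^(|w|^2/2) times the Weyl translate of the constant 1, so the only integral to
    evaluate is the Gaussian one. *)
Lemma fock_norm2_kernel w : fock_norm2 (fock_kernel w) = (expR (cmod w ^+ 2))%:E.
Proof.
have e1 := entire_weyl w _ (entire_cst (1 : R[i])).
have -> : fock_kernel w = fun z => cexp ((cmod w ^+ 2 / 2)%:C) * weyl w (fun=> 1) z.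
  by apply/funext => z; rewrite /weyl mulr1 -cexpD [_%:C + _]addrC subrK.
rewrite fock_norm2_scale// fock_norm2_weyl; last exact: entire_cst.
by rewrite fock_norm2_cst1 mule1 cmod_cexp -expRM_natl /=; congr (expR _)%:E; field.
Qed.

Lemma fock_norm_scale_kernel k w :
  fock_norm (fun z => k * fock_kernel w z) = cmod k * expR (cmod w ^+ 2 / 2).
Proof.
rewrite /fock_norm fock_norm2_scale; last exact: entire_kernel.
rewrite fock_norm2_kernel -EFinM /= sqrtrM ?sqr_ge0// sqrtr_sqr ger0_norm ?cmod_ge0//.
congr (_ * _); rewrite -[RHS]ger0_norm ?expR_ge0// -sqrtr_sqr -expRM_natl.
by congr (Num.sqrt (expR _)); field.
Qed.

Lemma in_fock_scale_kernel k w : in_fock (fun z => k * fock_kernel w z).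
Proof.
split; first exact: (entireM _ _ (entire_cst k) (entire_kernel w)).
rewrite fock_norm2_scale; last exact: entire_kernel.
by rewrite fock_norm2_kernel -EFinM ltry.
Qed.

Lemma wcomp_scale_kernel a b c k w :
  wcomp (fock_kernel c) (fun z => a * z + b) (fun z => k * fock_kernel w z) =
  fun z => (k * cexp (cconj w * b)) * fock_kernel (c + cconj a * w) z.
Proof.
apply/funext => z; rewrite /wcomp /fock_kernel [LHS]mulrCA -[RHS]mulrA -!cexpD.
congr (_ * cexp _).
by rewrite !cconjE rmorphD rmorphM /= conjcK; ring.
Qed.

(* The operator is a multiple of W_u D_a W_{-w}, where D_a g = g (a .) is a
   contraction and W_u, W_{-w} are the isometries [weyl]. *)
Lemma wcomp_weyl a b c w f : b = w - a * (c + cconj a * w) ->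
  let u := c + cconj a * w in
  wcomp (fock_kernel c) (fun z => a * z + b) f =
  fun z => cexp ((cmod u ^+ 2 / 2 - cmod w ^+ 2 / 2)%:C + cconj w * b) *
    weyl u (fun y => weyl (- w) f (a * y)) z.
Proof.
move=> bE u; apply/funext => z; rewrite /wcomp /fock_kernel /weyl.
rewrite (_ : a * (z - u) - - w = a * z + b); last by rewrite bE /u; ring.
have A x y t : cexp x * (cexp y * t) = cexp (x + y) * t :> R[i].
  by rewrite cexpD; exact: mulrA.
rewrite !A; congr (cexp _ * _).
rewrite cmodN rmorphB /= .
have h x : (cmod x ^+ 2 / 2)%:C = x * cconj x / 2 :> R[i].
  by rewrite rmorphM/= cmod_sqrC fmorphV rmorph_nat.
by rewrite !h bE /u !cconjE !(rmorphD, rmorphM, rmorphN)/= !conjcK; field.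
Qed.

Lemma wcomp_norm_eq a b c w : cmod a <= 1 -> b = w - a * (c + cconj a * w) ->
  wcomp_norm (fock_kernel c) (fun z => a * z + b) =
  (expR (cmod (c + cconj a * w) ^+ 2 / 2 - cmod w ^+ 2 / 2 + Re (cconj w * b)))%:E.
Proof.
move=> a1 bE; set u := c + cconj a * w; set C := expR _.
apply/eqP; rewrite eq_le; apply/andP; split.
  apply: ge_ereal_sup => _ [f [[ef fF] f1] <-]; rewrite lee_fin.
  suff : (fock_norm2 (wcomp (fock_kernel c) (fun z => a * z + b)%R f) <= (C ^+ 2)%:E * fock_norm2 f)%E.
    (* [fock_norm] would read an infinite squared norm as 0, so both squared norms are shown finite
       before taking roots. *)
    rewrite /fock_norm in f1 *; move: (fock_norm2_ge0 f) fF f1.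
    case: (fock_norm2 f) => //= r r0 _ r1; rewrite -EFinM => le1.
    move: (fock_norm2_ge0 (wcomp (fock_kernel c) (fun z => a * z + b) f)) le1.
    case: (fock_norm2 (wcomp _ _ f)) => //= q q0; rewrite lee_fin => le1.
    rewrite (le_trans (ler_wsqrtr le1))// sqrtrM ?sqr_ge0// sqrtr_sqr.
    by rewrite ger0_norm ?expR_ge0// -[leRHS]mulr1 ler_wpM2l ?expR_ge0.
  have eW := entire_weyl (- w) f ef.
  have eD : entire (fun y => weyl (- w) f (a * y)).
    exact: (entire_comp _ _ eW (entire_linear a)).
  rewrite (wcomp_weyl a b c w f bE) fock_norm2_scale; last exact: entire_weyl.
  rewrite fock_norm2_weyl// cmod_cexp cReD /= -/u -/C.
  rewrite lee_wpmul2l ?lee_fin ?sqr_ge0//.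
  by rewrite -(fock_norm2_weyl (- w) f ef); exact: fock_norm2_dilation.
pose k : R[i] := cexp (- (cmod w ^+ 2 / 2))%:C.
apply: ereal_sup_ubound; exists (fun z => k * fock_kernel w z).
  split; first exact: in_fock_scale_kernel.
  by rewrite fock_norm_scale_kernel /k cmod_cexp /= -expRD addNr expR0.
rewrite wcomp_scale_kernel fock_norm_scale_kernel -/u cmodM !cmod_cexp /=.
by rewrite -!expRD /C; congr (expR _)%:E; ring.
Qed.

Lemma wcomp_bounded_unit a b c : cmod a = 1 ->
  wcomp_bounded (fock_kernel c) (fun z => a * z + b) -> b + a * c = 0.
Proof.
move=> a1 [_ [M bM]]; set q := b + a * c.
apply/eqP; rewrite -cmod_eq0; apply/eqP; apply: contrapT => /eqP q0.
have {}q0 : 0 < cmod q ^+ 2 by rewrite exprn_gt0// lt_def q0 cmod_ge0.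
(* This w makes Re (conj w q) equal to |M|. The bound on K_w then reads e^E <= M with E >= |M|,
   against 1 + E <= e^E. *)
pose t := `|M| / cmod q ^+ 2; pose w := t%:C * q.
have := bM _ (in_fock_scale_kernel 1 w).
rewrite wcomp_scale_kernel !fock_norm_scale_kernel mul1r cmod1 mul1r cmod_cexp.
rewrite -expRD -ler_pdivrMr ?expR_gt0// -expRB.
set E := _ - _ => le1.
have EE : E = cmod c ^+ 2 / 2 + `|M|.
  have wE : t * cmod q ^+ 2 = `|M| by rewrite /t divfK// gt_eqF.
  have aE : Re a ^+ 2 + Im a ^+ 2 = 1 by rewrite -cmod_sqr a1 expr1n.
  rewrite -wE /E !cmod_sqr /w /q; case: (a) (b) (c) aE => [a2 a3] [b1 b2] [c1 c2] /= aE.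
  apply/eqP; rewrite -subr_eq0; apply/eqP.
  (* The two sides differ by (|a|^2 - 1) |w|^2 / 2, the quadratic part of the exponent, which
     vanishes on the unit circle. *)
  transitivity ((a2 ^+ 2 + a3 ^+ 2 - 1) * (t ^+ 2 *
    ((b1 + (a2 * c1 - a3 * c2)) ^+ 2 + (b2 + (a2 * c2 + a3 * c1)) ^+ 2) / 2)).
    by field.
  by rewrite aE subrr mul0r.
have : 1 + E <= expR E := expR_ge1Dx E.
have := ler_norm M; have := sqr_ge0 (cmod c); rewrite EE in le1 *; lra.
Qed.

End weighted_composition.

Theorem theorem4p2 (R : realType) (a b c : R[i]) :
  cmod a <= 1 ->
  wcomp_bounded (fock_kernel c) (fun z => a * z + b) ->
  [/\ (cmod a < 1 ->
        wcomp_norm (fock_kernel c) (fun z => a * z + b) =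
        (cmod (cexp (cconj c * b / (1 - a))) *
         expR (2^-1 * (cmod (c * (1 - a) / (cconj a - 1) + b) ^+ 2
                       / (1 - cmod a ^+ 2))))%:E),
      (cmod a = 1 -> a != 1 ->
        wcomp_norm (fock_kernel c) (fun z => a * z + b) =
        (cmod (cexp ((cmod b ^+ 2)%:C / (1 - cconj a))))%:E)
    & (a = 1 ->
        wcomp_norm (fock_kernel c) (fun z => a * z + b) =
        (expR (cmod b ^+ 2 / 2))%:E)].
Proof.
move=> a1 bd.
have unit_norm : cmod a = 1 -> wcomp_norm (fock_kernel c) (fun z => a * z + b) =
    (expR (cmod b ^+ 2 / 2))%:E.
  move=> a_unit; have bac := wcomp_bounded_unit a b c a_unit bd.
  have bE : b = - (a * c) by apply/eqP; rewrite -addr_eq0 bac.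
  rewrite (wcomp_norm_eq a b c 0) ?mulr0 ?addr0 ?add0r//.
  congr (expR _)%:E.
  rewrite cmod0 expr0n /= mul0r subr0 [cconj 0](_ : _ = 0); last by rewrite cconjE rmorph0.
  by rewrite mul0r /= addr0 bE cmodN cmodM a_unit mul1r.
have conjD x y : (x + y)^*%C = x^*%C + y^*%C :> R[i] by exact: rmorphD.
have conjN x : (- x)^*%C = - x^*%C :> R[i] by exact: rmorphN.
have conjM x y : (x * y)^*%C = x^*%C * y^*%C :> R[i] by exact: rmorphM.
split=> [a_lt1|a_unit a_neq1|a_eq1]; last by apply: unit_norm; rewrite a_eq1 cmod1.
- pose n : R := 1 - cmod a ^+ 2.
  have n0 : n != 0.
    by rewrite gt_eqF// subr_gt0 expr_lt1// cmod_ge0.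
  have nE : n%:C = 1 - a * a^*%C :> R[i] by rewrite rmorphB /= cmod_sqrC cconjE.
  have nC : 1 - a * a^*%C != 0 by rewrite -nE -[0]/(0%:C) (inj_eq (@complexI R)).
  have a_neq1 : 1 - a != 0.
    by rewrite subr_eq0; apply: contraTneq a_lt1 => <-; rewrite cmod1 ltxx.
  have aJ_neq1 : a^*%C - 1 != 0.
    by rewrite -[1]conjc1 -rmorphB conjc_eq0 -opprB oppr_eq0.
  pose w := (b + a * c) / (1 - a * a^*%C).
  rewrite (wcomp_norm_eq a b c w)//; last by rewrite cconjE /w; field.
  rewrite cmod_cexp -expRD; congr (expR _)%:E; apply: complexI.
  have sqC z : (cmod z ^+ 2)%:C = z * z^*%C :> R[i] by rewrite cmod_sqrC cconjE.
  have halfC (x : R) : (x / 2)%:C = x%:C / 2 :> R[i] by rewrite rmorphM/= fmorphV/= rmorph_nat.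
  pose u := c + a^*%C * w; pose d := c * (1 - a) / (a^*%C - 1) + b.
  pose e := c^*%C * b / (1 - a).
  (* Real parts are written as (z + conj z) / 2, so that the equality of exponents becomes a
     rational identity in a, b, c and their conjugates, treated as independent variables. *)
  transitivity (u * u^*%C / 2 - w * w^*%C / 2 + (w^*%C * b + (w^*%C * b)^*%C) / 2).
    by rewrite rmorphD rmorphB /= !halfC !sqC ReJ_add !cconjE.
  transitivity ((e + e^*%C) / 2 + d * d^*%C / (1 - a * a^*%C) / 2); last first.
    rewrite [RHS]rmorphD [X in _ = X + _]ReJ_add !cconjE; congr (_ + _).
    by rewrite [X in _ = X%:C]mulrC halfC -/d -/n rmorphM /= fmorphV /= sqC nE.
  rewrite /u /e /d /w !(conjD, conjN, conjM, conjc_inv, conjc1, conjcK).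
  field; apply/and5P; split; [exact: nC| |exact: aJ_neq1| |exact: a_neq1].
    by rewrite -opprB oppr_eq0.
  by rewrite -opprB oppr_eq0; exact: aJ_neq1.
- have a0 : a != 0 by rewrite -cmod_eq0 a_unit oner_neq0.
  have aJ : a^*%C = a^-1.
    by apply: (mulfI a0); rewrite divff// -cconjE -cmod_sqrC a_unit expr1n.
  have a1n : 1 - a != 0 by rewrite subr_eq0 eq_sym.
  (* On the unit circle away from 1, the real part of 1 / (1 - conj a) is 1/2, so the stated value
     is again e^(|b|^2/2). *)
  rewrite unit_norm// cmod_cexp; congr (expR _)%:E; apply: complexI.
  rewrite [RHS]ReJ_add cconjE; set B := _ ^+ 2.
  rewrite !(conjD, conjN, conjM, conjc_inv, conjc1, conjcK, conjc_real) aJ.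
  have -> : (B / 2)%:C = B%:C / 2 :> R[i] by rewrite rmorphM/= fmorphV/= rmorph_nat.
  by field; apply/and3P; split=> //; rewrite -opprB oppr_eq0.
Qed.
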